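(* There exist absolute constants $C,C'>0$ such that the following holds. Suppose $P$ is weakly communicating, $\delta\in(0,1)$, and $n$ is such that $\gamma:=1-\sqrt{C\log^3(SAn^2/\delta)/n}\in(0,1)$. Then with probability at least $1-\delta$, every policy $\widehat\pi$ satisfying $\widehat V^{\widehat\pi}_\gamma\ge\widehat V^\star_\gamma-\frac1n\mathbf 1$ satisfies $$\rho^\star-\rho^{\widehat\pi}\le\sqrt{\frac{C'\log^3\!\big(\frac{SAn}{\delta}\big)}{n}\big(\|h^\star\|_{\mathrm{sp}}^2+1\big)}\;\mathbf 1 .$$
   Context: $\mathcal S$ finite with $S$ states, $\mathcal A$ finite with $A$ actions; transition kernel $P$; known reward $r:\mathcal S\times\mathcal A\to[0,1]$. Policies stationary Markov, possibly randomized; $P_\pi,r_\pi$ induced matrix/reward. Empirical kernel $\widehat P$: $n$ i.i.d. samples from each $P(\cdot|s,a)$, independent across pairs, $\widehat P(s'|s,a)$ = fraction equal to $s'$. $\widehat V^\pi_\gamma=(I-\gamma\widehat P_\pi)^{-1}r_\pi$, $\widehat V^\star_\gamma=\max_\pi\widehat V^\pi_\gamma$. Gain $\rho^\pi=P^\infty_\pi r_\pi$ ($P^\infty_\pi$ Cesàro limit of $P_\pi^t$), bias $h^\pi=\mathrm{C\text{-}lim}_T\sum_{t<T}(P^t_\pi r_\pi-\rho^\pi)$; $\rho^\star,h^\star$ gain and bias of a Blackwell-optimal policy of $(P,r)$. $\|x\|_{\mathrm{sp}}=\max x-\min x$. Weakly communicating: states split into states transient under every stationary policy and a set where every state is reachable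 from every other. *)

(* Defs.v *)
From HB Require Import structures.
From mathcomp Require Import all_boot all_order all_algebra.
From mathcomp Require Import all_classical all_reals all_analysis.
Set Implicit Arguments. Unset Strict Implicit. Unset Printing Implicit Defensive.
Import Order.TTheory GRing.Theory Num.Theory numFieldNormedType.Exports.
Local Open Scope ring_scope.
Local Open Scope classical_set_scope.

Section MDP.
Variables (R : realType) (S A : finType).

Definition is_kernel (P : S -> A -> S -> R) : Prop :=
  (forall s a s', 0 <= P s a s') /\ (forall s a, \sum_(s' : S) P s a s' = 1).

Definition is_policy (pi : S -> A -> R) : Prop :=
  (forall s a, 0 <= pi s a) /\ (forall s, \sum_(a : A) pi s a = 1).

Definition Ppi (P : S -> A -> S -> R) (pi : S -> A -> R) (s s' : S) : R :=
  \sum_(a : A) pi s a * P s a s'.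
Definition rpi (r : S -> A -> R) (pi : S -> A -> R) (s : S) : R :=
  \sum_(a : A) pi s a * r s a.

Definition mx_of (M : S -> S -> R) : 'M[R]_#|S| :=
  \matrix_(i, j) M (enum_val i) (enum_val j).
Definition cv_of (v : S -> R) : 'cV[R]_#|S| := \col_i v (enum_val i).
Definition fun_of_cv (v : 'cV[R]_#|S|) (s : S) : R := v (enum_rank s) ord0.

Definition Vdisc (P : S -> A -> S -> R) (r : S -> A -> R) (gamma : R)
    (pi : S -> A -> R) : S -> R :=
  fun_of_cv (invmx (1%:M - gamma *: mx_of (Ppi P pi)) *m cv_of (rpi r pi)).

Definition Vopt (P : S -> A -> S -> R) (r : S -> A -> R) (gamma : R) (s : S) : R :=
  sup [set Vdisc P r gamma pi s | pi in is_policy].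

Definition Ppow (P : S -> A -> S -> R) (pi : S -> A -> R) (t : nat) (s s' : S) : R :=
  (mx_of (Ppi P pi) ^+ t) (enum_rank s) (enum_rank s').

Definition cesaro_lim (u : nat -> R) : R :=
  limn ((fun T : nat => (T.+1%:R : R)^-1 * \sum_(k < T.+1) u k) : nat -> R).

Definition Pinf (P : S -> A -> S -> R) (pi : S -> A -> R) (s s' : S) : R :=
  cesaro_lim (fun t => Ppow P pi t s s').

Definition gain (P : S -> A -> S -> R) (r : S -> A -> R) (pi : S -> A -> R) (s : S) : R :=
  \sum_(s' : S) Pinf P pi s s' * rpi r pi s'.

Definition bias (P : S -> A -> S -> R) (r : S -> A -> R) (pi : S -> A -> R) (s : S) : R :=
  cesaro_lim (fun T => \sum_(t < T)
     ((\sum_(s' : S) Ppow P pi t s s' * rpi r pi s') - gain P r pi s)).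

Definition blackwell_optimal (P : S -> A -> S -> R) (r : S -> A -> R)
    (pi : S -> A -> R) : Prop :=
  is_policy pi /\
  exists gamma0 : R, 0 <= gamma0 < 1 /\
    forall gamma : R, gamma0 < gamma < 1 ->
      forall pi', is_policy pi' -> forall s, Vdisc P r gamma pi' s <= Vdisc P r gamma pi s.

Definition sp_norm (h : S -> R) : R :=
  sup [set h s | s in [set: S]] - inf [set h s | s in [set: S]].

(* transience of a state in the chain P_pi: return probability < 1.
   First return at time t+1 has probability (Q^t P_pi)(s,s), where Q is P_pi
   with the column of s zeroed (taboo matrix). *)
Definition first_return (P : S -> A -> S -> R) (pi : S -> A -> R) (s : S) (t : nat) : R :=
  ((mx_of (fun x y => if y == s then 0 else Ppi P pi x y)) ^+ t *m mx_of (Ppi P pi))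
    (enum_rank s) (enum_rank s).
Definition transient (P : S -> A -> S -> R) (pi : S -> A -> R) (s : S) : Prop :=
  limn (series (first_return P pi s) : nat -> R) < 1.

Definition weakly_communicating (P : S -> A -> S -> R) : Prop :=
  exists Cl : {set S},
    (forall s, s \notin Cl -> forall pi, is_policy pi -> transient P pi s) /\
    (forall s s', s \in Cl -> s' \in Cl ->
       exists pi, is_policy pi /\ exists t : nat, 0 < Ppow P pi t s s').

(* Sampling: n i.i.d. samples from each P(.|s,a), independent across pairs.
   An outcome is a finite function assigning to each pair an n-tuple of states. *)
Definition sample_prob (P : S -> A -> S -> R) (n : nat)
    (w : {ffun S * A -> n.-tuple S}) : R :=
  \prod_(sa : S * A) \prod_(i < n) P sa.1 sa.2 (tnth (w sa) i).

Definition Phat (n : nat) (w : {ffun S * A -> n.-tuple S}) (s : S) (a : A) (s' : S) : R :=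
  (count (pred1 s') (w (s, a)))%:R / n%:R.

Definition Prob (P : S -> A -> S -> R) (n : nat)
    (E : {ffun S * A -> n.-tuple S} -> Prop) : R :=
  \sum_(w | `[< E w >]) @sample_prob P n w.

End MDP.

Arguments sample_prob {R S A} P n w.
Arguments Prob {R S A} P n E.
Arguments Phat {R S A} n w s a s'.

(* Main.v *)
(** Write [b = 1 - gamma], [rho = rho*], [h = h*] and [H = sp(h)]. Blackwell optimality and
   weak communication make [rho] constant and give the Bellman inequality
   [r + P h <= rho + h], so that [v = rho / b + h - min h] is a fixed point of the discounted
   Bellman operator up to [b H]. Concentration of [Phat h] then places the empirical value
   [V] of the near-optimal policy within [2 H + 1] of [v]. The span of [V] is therefore of
   order [H + 1], and [(P - Phat) V] is of order [b (H + 1)]: although [V] depends on the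
   samples of a pair [(s, a)], it is within [3 b] of the value of a model in which the backup
   at [(s, a)] is frozen to one of [n^2 + 1] grid constants, which is independent of those
   samples. Finally [r_pi = V - gamma Phat_pi V] is integrated against the stationary
   distributions of [P_pi], where [V - P_pi V] vanishes. *)
Require Import Defs.
From HB Require Import structures.
From mathcomp Require Import all_boot all_order all_algebra.
From mathcomp Require Import all_classical all_reals all_analysis.
From mathcomp Require Import ring lra.
Set Implicit Arguments. Unset Strict Implicit. Unset Printing Implicit Defensive.
Import Order.TTheory GRing.Theory Num.Theory numFieldNormedType.Exports.
Local Open Scope ring_scope.

(** The number [b] is both [1 - gamma] and the relative radius of concentration: the sample mean of
    a function of span [D] errs by at most [D b], and the horizon [1 / b] turns this one-step error
    into [D]. Such a bound fails with probability at most [2 exp (- n b^2 / 8) = 2 exp (- 8 L^3)],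
    which pays for the union bound once [L >= 1/2]. The obstacle is that [pihat] is arbitrary and
    chosen after the sampling. Near-optimality makes its value solve the empirical Bellman
    optimality equation up to [1 / n], and the solution of that equation depends on the samples
    alone. Hence the good event mentions only [h] and the leave-one-out values, and serves every
    [pihat] at once. The grid is affordable because backups lie in [[0, 1 / b]] with [1 / b <= n],
    and mesh [1 / n <= b^2] costs only order [b] after amplification by the horizon. *)

(** * Averages on a finite set and the maximum principle *)

Section Averages.
Variables (R : realType) (S : finType).
Implicit Types (p f g : S -> R) (M : S -> S -> R).

Definition avg p f : R := \sum_s p s * f s.
Definition is_dist p : Prop := (forall s, 0 <= p s) /\ \sum_s p s = 1.

Lemma avg_ext p f g : f =1 g -> avg p f = avg p g.
Proof. by move=> fg; apply: eq_bigr => s _; rewrite fg. Qed.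

Lemma avgD p f g : avg p (fun s => f s + g s) = avg p f + avg p g.
Proof. by rewrite /avg -big_split; apply: eq_bigr => s _; rewrite mulrDr. Qed.

Lemma avgN p f : avg p (fun s => - f s) = - avg p f.
Proof. by rewrite /avg -sumrN; apply: eq_bigr => s _; rewrite mulrN. Qed.

Lemma avgB p f g : avg p (fun s => f s - g s) = avg p f - avg p g.
Proof. by rewrite avgD avgN. Qed.

Lemma avgZ p c f : avg p (fun s => c * f s) = c * avg p f.
Proof. by rewrite /avg mulr_sumr; apply: eq_bigr => s _; rewrite mulrCA. Qed.

Lemma avg_sum (I : finType) (F : I -> S -> R) p :
  avg p (fun s => \sum_i F i s) = \sum_i avg p (F i).
Proof.
by rewrite /avg exchange_big; apply: eq_bigr => s _; rewrite mulr_sumr.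
Qed.

Lemma avg_suml (I : finType) (w : I -> R) (q : I -> S -> R) f :
  avg (fun s => \sum_i w i * q i s) f = \sum_i w i * avg (q i) f.
Proof.
rewrite /avg (eq_bigr (fun s => \sum_i w i * q i s * f s)).
  rewrite exchange_big; apply: eq_bigr => i _; rewrite mulr_sumr.
  by apply: eq_bigr => s _; rewrite mulrA.
by move=> s _; rewrite mulr_suml.
Qed.

Lemma avg_delta p s : avg p (fun t => (t == s)%:R) = p s.
Proof.
rewrite /avg (bigD1 s) //= eqxx mulr1 big1 ?addr0 // => t /negPf ->.
by rewrite mulr0.
Qed.

Lemma avg_cst p c : is_dist p -> avg p (fun=> c) = c.
Proof. by case=> _ p1; rewrite /avg -mulr_suml p1 mul1r. Qed.

Lemma avg_mono p f g : (forall s, 0 <= p s) ->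
  (forall s, f s <= g s) -> avg p f <= avg p g.
Proof. by move=> p0 fg; apply: ler_sum => s _; rewrite ler_wpM2l. Qed.

Lemma avg_le p f c : is_dist p -> (forall s, f s <= c) -> avg p f <= c.
Proof.
by move=> dp fc; rewrite -(avg_cst c dp); apply: avg_mono => //; case: dp.
Qed.

Lemma avg_ge p f c : is_dist p -> (forall s, c <= f s) -> c <= avg p f.
Proof.
by move=> dp fc; rewrite -(avg_cst c dp); apply: avg_mono => //; case: dp.
Qed.

Lemma avg_norm p f c : is_dist p -> (forall s, `|f s| <= c) -> `|avg p f| <= c.
Proof.
move=> dp fc; rewrite ler_norml; apply/andP; split.
  by apply: avg_ge => // s; have := fc s; rewrite ler_norml => /andP[].
by apply: avg_le => // s; have := fc s; rewrite ler_norml => /andP[].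
Qed.

Lemma exists_argmax f (s0 : S) : exists s, forall t, f t <= f s.
Proof. by case: (arg_maxP f (erefl (xpredT s0))) => s _ H; exists s => t; apply: H. Qed.

(* Evaluate the hypothesis at a state where [x] is maximal. *)
Lemma discounted_max_principle M (gamma c : R) (x : S -> R) :
  (forall s, is_dist (M s)) -> 0 <= gamma < 1 ->
  (forall s, x s <= c + gamma * avg (M s) x) -> forall s, x s <= c / (1 - gamma).
Proof.
move=> dM /andP[g0 g1] H s; have [m Hm] := exists_argmax x s.
apply: (le_trans (Hm s)); rewrite ler_pdivlMr ?subr_gt0 //.
have := H m; have := avg_le (dM m) Hm => /(ler_wpM2l g0); lra.
Qed.

Lemma iter_avg_bound M f c t : (forall s, is_dist (M s)) ->
  (forall s, `|f s| <= c) -> forall s, `|iter t (fun f s => avg (M s) f) f s| <= c.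
Proof. by move=> dM fc; elim: t => //= t IH s; apply: avg_norm. Qed.

Lemma exists_bound f : exists2 c, 0 <= c & forall s, `|f s| <= c.
Proof.
exists (\sum_s `|f s|); first exact: sumr_ge0.
by move=> s; rewrite (bigD1 s) //= lerDl sumr_ge0.
Qed.

End Averages.


(** * Limits from bounded errors *)

Section LinearGrowth.
Variable R : realType.

(** Replaces division by [T] and passage to the limit: identities between Cesàro limits are proved
    below by exhibiting a bounded error. *)
Lemma linear_bounded_below_ge0 (c x : R) :
  (forall T : nat, - c <= T%:R * x) -> 0 <= x.
Proof.
move=> H; rewrite leNgt; apply/negP => x0.
have c0 : 0 <= c by have := H 0%N; rewrite mul0r lerNl oppr0.
have := H (Num.truncn (c / - x)).+1.
have := truncnS_gt (c / - x); rewrite ltr_pdivrMr ?oppr_gt0 //; lra.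
Qed.

Lemma linear_bounded_eq0 (c x : R) : (forall T : nat, `|T%:R * x| <= c) -> x = 0.
Proof.
move=> H; apply/eqP; rewrite eq_le; apply/andP; split.
  rewrite -oppr_ge0; apply: (@linear_bounded_below_ge0 c) => T.
  by have := H T; rewrite mulrN lerN2 ler_norml => /andP[].
apply: (@linear_bounded_below_ge0 c) => T.
by have := H T; rewrite ler_norml => /andP[].
Qed.

(** A bounded error of the partial sums is an [O(1/T)] rate for the means, so convergence and the
    value of the limit come together. *)
Lemma cesaro_limE (u : nat -> R) (l c : R) :
  (forall T : nat, `|\sum_(k < T) u k - T%:R * l| <= c) -> cesaro_lim u = l.
Proof.
move=> H; apply: cvg_lim => //.
have c0 : 0 <= c by exact: le_trans (H 0%N).
apply: (@squeeze_cvgr _ _ _ _ (fun T => l - c * harmonic T)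
  (fun T => l + c * harmonic T)).
- apply: nearW => T; rewrite /harmonic /=.
  have T0 : 0 < T.+1%:R :> R by rewrite ltr0Sn.
  have := H T.+1; rewrite ler_norml => /andP[H1 H2].
  rewrite [_^-1 * _]mulrC; apply/andP; split.
    rewrite ler_pdivlMr // mulrBl mulfVK ?gt_eqF //; lra.
  rewrite ler_pdivrMr // mulrDl mulfVK ?gt_eqF //; lra.
- rewrite -[X in (_ --> X)%classic]subr0 -[X in (_ --> _ - X)%classic](mulr0 c).
  by apply: cvgB; [exact: cvg_cst | apply: cvgMl_tmp; exact: cvg_harmonic].
- rewrite -[X in (_ --> X)%classic]addr0 -[X in (_ --> _ + X)%classic](mulr0 c).
  by apply: cvgD; [exact: cvg_cst | apply: cvgMl_tmp; exact: cvg_harmonic].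
Qed.

End LinearGrowth.

(** * From matrices to operators on functions *)

Section MatrixTransfer.
Variables (R : realType) (S : finType).
Implicit Types (f g : S -> R) (M : S -> S -> R).

Definition step M f : S -> R := fun s => avg (M s) f.

Lemma fun_of_cvK (v : 'cV[R]_#|S|) : cv_of (fun_of_cv v) = v.
Proof. by apply/matrixP => i j; rewrite !mxE /fun_of_cv enum_valK (ord1 j). Qed.

Lemma cv_ofK f : fun_of_cv (cv_of f) = f.
Proof. by apply/funext => s; rewrite /fun_of_cv mxE enum_rankK. Qed.

Lemma sum_enum_val (F : S -> R) : \sum_(i < #|S|) F (enum_val i) = \sum_s F s.
Proof.
by rewrite -[LHS](big_enum_val (A := S)); apply: eq_bigl.
Qed.

Lemma fun_of_cv_mul M (v : 'cV[R]_#|S|) :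
  fun_of_cv (mx_of M *m v) = step M (fun_of_cv v).
Proof.
apply/funext => s; rewrite /fun_of_cv /step /avg !mxE -sum_enum_val.
by apply: eq_bigr => i _; rewrite mxE enum_valK enum_rankK.
Qed.

Lemma fun_of_cvB (v w : 'cV[R]_#|S|) s :
  fun_of_cv (v - w) s = fun_of_cv v s - fun_of_cv w s.
Proof. by rewrite /fun_of_cv !mxE. Qed.

Lemma fun_of_cvZ (v : 'cV[R]_#|S|) c s : fun_of_cv (c *: v) s = c * fun_of_cv v s.
Proof. by rewrite /fun_of_cv !mxE. Qed.

Lemma fun_of_cv_pow M t (v : 'cV[R]_#|S|) :
  fun_of_cv (mx_of M ^+ t *m v) = iter t (step M) (fun_of_cv v).
Proof.
elim: t => [|t IH]; first by rewrite expr0 mul1mx.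
by rewrite exprS -mulmxA fun_of_cv_mul IH.
Qed.

(** Turns the entries in [Ppow] and [first_return] into iterates of [step] on indicator
    functions. *)
Lemma mx_entryE (B : 'M[R]_#|S|) s s' :
  B (enum_rank s) (enum_rank s') = fun_of_cv (B *m cv_of (fun t => (t == s')%:R)) s.
Proof.
rewrite /fun_of_cv mxE (bigD1 (enum_rank s')) //= mxE enum_rankK eqxx mulr1.
rewrite big1 ?addr0 // => i ni; rewrite mxE -(inj_eq enum_rank_inj) enum_valK.
by rewrite (negPf ni) mulr0.
Qed.

End MatrixTransfer.

(** * Ergodic theory of a finite Markov chain *)

Section Ergodic.
Variables (R : realType) (S : finType) (M : S -> S -> R).
Hypothesis dM : forall s, is_dist (M s).
Implicit Types (f g : S -> R).

Lemma iter_stepD t f g s : iter t (step M) (fun s => f s + g s) s =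
  iter t (step M) f s + iter t (step M) g s.
Proof.
by elim: t s => //= t IH s; rewrite /step -avgD; exact: avg_ext.
Qed.

Lemma iter_stepN t f s :
  iter t (step M) (fun s => - f s) s = - iter t (step M) f s.
Proof.
by elim: t s => //= t IH s; rewrite /step -avgN; exact: avg_ext.
Qed.

Lemma iter_stepE t f s :
  iter t (step M) f s = \sum_s' f s' * iter t (step M) (fun x => (x == s')%:R) s.
Proof.
elim: t s => [s|t IH s] /=.
  rewrite (bigD1 s) //= eqxx mulr1 big1 ?addr0 // => i /negPf.
  by rewrite eq_sym => ->; rewrite mulr0.
rewrite {1}/step (avg_ext _ IH) avg_sum; apply: eq_bigr => s' _.
by rewrite /step avgZ.
Qed.

Lemma iter_step_fixed t f s : (forall s, step M f s = f s) ->
  iter t (step M) f s = f s.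
Proof.
move=> fix_f; elim: t s => //= t IH s.
by rewrite -[RHS]fix_f; apply: avg_ext.
Qed.

Lemma iter_step_coboundary t g s :
  iter t (step M) (fun s => g s - step M g s) s =
  iter t (step M) g s - iter t.+1 (step M) g s.
Proof. by rewrite (iter_stepD t g) iter_stepN iterSr. Qed.

(* With [y = g - M g] fixed by [M], the bounded sequence [M^t g] is [g - t y]. *)
Lemma coboundary_fixed_eq0 g s :
  (forall s, step M (fun s => g s - step M g s) s = g s - step M g s) ->
  g s - step M g s = 0.
Proof.
set y := fun s => _ - _ => fixy.
have [c c0 gc] := exists_bound g.
apply: (@linear_bounded_eq0 _ (c + c)) => t.
suff -> : t%:R * (g s - step M g s) = g s - iter t (step M) g s.
  apply: (le_trans (ler_normB _ _)); apply: lerD; first exact: gc.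
  exact: iter_avg_bound.
elim: t => [|t IH]; first by rewrite mul0r subrr.
rewrite -natr1 mulrDl mul1r IH.
have -> : g s - step M g s = iter t (step M) y s by rewrite iter_step_fixed.
rewrite iter_step_coboundary /=; ring.
Qed.

(** The kernel and the image of [I - M] meet only in 0, since a fixed coboundary vanishes; by
    rank-nullity they span the whole space. *)
Lemma ergodic_decomposition f : exists rho g,
  (forall s, step M rho s = rho s) /\ forall s, f s = rho s + g s - step M g s.
Proof.
(* Kernels and spans are taken on rows, hence the transpose: up to transposition [kermx B] is the
   kernel of [I - M], and the row space of [B] is its image. *)
pose N : 'M[R]_#|S| := 1%:M - mx_of M; pose B := N^T.
have NE v s : fun_of_cv (N *m v) s = fun_of_cv v s - step M (fun_of_cv v) s.
  by rewrite mulmxBl mul1mx fun_of_cvB fun_of_cv_mul.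
have disj : (kermx B :&: B)%MS = 0.
  apply/eqP/rowV0P => u; rewrite sub_capmx => /andP[/sub_kermxP uB /submxP[w uw]].
  apply: trmx_inj; rewrite trmx0.
  have uE : u^T = N *m w^T by rewrite uw trmx_mul trmxK.
  have uN : N *m u^T = 0 by rewrite -[N]trmxK -trmx_mul uB trmx0.
  rewrite -[LHS]fun_of_cvK; apply/matrixP => i j; rewrite !mxE.
  rewrite uE NE; apply: coboundary_fixed_eq0 => s.
  have := NE u^T s; rewrite uN {1}/fun_of_cv mxE => /esym/eqP.
  rewrite subr_eq0 => /eqP/esym; rewrite uE NE => E.
  by rewrite -[RHS]E; apply: avg_ext => t; rewrite NE.
have full : row_full (kermx B + B)%MS.
  by rewrite /row_full mxrank_disjoint_sum // mxrank_ker subnK ?rank_leq_row.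
have /sub_addsmxP[[u1 u2] /= fE] := submx_full (cv_of f)^T full.
exists (fun_of_cv (u1 *m kermx B)^T), (fun_of_cv u2^T); split=> s.
  have := NE (u1 *m kermx B)^T s.
  rewrite -[N]trmxK -trmx_mul -mulmxA mulmx_ker mulmx0 trmx0 {1}/fun_of_cv mxE.
  by move/esym/eqP; rewrite subr_eq0 => /eqP.
rewrite -addrA -NE -{1}(cv_ofK f) -[cv_of f]trmxK fE linearD /= trmx_mul.
by rewrite [(u2 *m B)^T]trmx_mul trmxK {1}/fun_of_cv mxE.
Qed.

(** The fixed part of the decomposition contributes exactly [T rho], and the coboundary telescopes
    to [g - M^T g]. *)
Lemma cesaro_bounded f : exists rho : S -> R, (forall s, step M rho s = rho s) /\
  exists c, forall s T, `|\sum_(k < T) iter k (step M) f s - T%:R * rho s| <= c.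
Proof.
have [rho [g [fix_rho fE]]] := ergodic_decomposition f.
exists rho; split => //; have [c c0 gc] := exists_bound g.
exists (c + c) => s T.
suff -> : \sum_(k < T) iter k (step M) f s =
    T%:R * rho s + g s - iter T (step M) g s.
  rewrite (_ : _ - _ = g s - iter T (step M) g s); last by ring.
  apply: (le_trans (ler_normB _ _)); apply: lerD; first exact: gc.
  exact: iter_avg_bound.
elim: T => [|T IH]; first by rewrite big_ord0 mul0r add0r subrr.
rewrite big_ord_recr /= IH -natr1 mulrDl mul1r.
have -> : f = fun s => rho s + (g s - step M g s).
  by apply/funext => t; rewrite fE addrA.
rewrite iter_stepD iter_step_coboundary (iter_step_fixed _ _ fix_rho) /=; ring.
Qed.

(** Row [s] of the Cesàro limit of the powers of [M]. It may depend on [s], as the chain may have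
    several recurrent classes. *)
Definition stat (s s' : S) : R :=
  cesaro_lim (fun t => iter t (step M) (fun x => (x == s')%:R) s).

(** Expanding [f] over indicators, each of which has bounded Cesàro error, shows that [T] times the
    difference of the two sides stays bounded. *)
Lemma statE f s l c :
  (forall T, `|\sum_(k < T) iter k (step M) f s - T%:R * l| <= c) ->
  avg (stat s) f = l.
Proof.
move=> fl; apply/eqP; rewrite -subr_eq0; apply/eqP.
pose d (s' x : S) : R := (x == s')%:R.
have /choice[rho rhoP] := fun s' => cesaro_bounded (d s').
have /choice[b bP] := fun s' => (rhoP s').2.
have statd s' : stat s s' = rho s' s by apply: cesaro_limE => T; exact: bP.
apply: (@linear_bounded_eq0 _ (\sum_s' `|f s'| * b s' + c)) => T.
have -> : T%:R * (avg (stat s) f - l) =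
   - (\sum_s' f s' * (\sum_(k < T) iter k (step M) (d s') s - T%:R * rho s' s))
   + (\sum_(k < T) iter k (step M) f s - T%:R * l).
  have -> : \sum_(k < T) iter k (step M) f s =
      \sum_s' f s' * \sum_(k < T) iter k (step M) (d s') s.
    under eq_bigr do rewrite iter_stepE.
    by rewrite exchange_big; apply: eq_bigr => s' _; rewrite mulr_sumr.
  have -> : avg (stat s) f = \sum_s' f s' * rho s' s.
    by apply: eq_bigr => s' _; rewrite statd mulrC.
  under [in RHS]eq_bigr => s' _ do rewrite mulrBr mulrCA.
  by rewrite sumrB -mulr_sumr; ring.
apply: (le_trans (ler_normD _ _)); apply: lerD; last exact: fl.
rewrite normrN; apply: (le_trans (ler_norm_sum _ _ _)); apply: ler_sum => s' _.
by rewrite normrM ler_wpM2l.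
Qed.

Lemma stat_harmonic f s : step M (fun s => avg (stat s) f) s = avg (stat s) f.
Proof.
have [rho [fix_rho [c cP]]] := cesaro_bounded f.
have E x : avg (stat x) f = rho x by apply: statE => T; exact: cP.
by rewrite E -fix_rho; apply: avg_ext.
Qed.

Lemma stat_fixed f s : (forall s, step M f s = f s) -> avg (stat s) f = f s.
Proof.
move=> fix_f; apply: (@statE _ _ _ 0) => T.
rewrite (eq_bigr (fun=> f s)); last by move=> k _; rewrite iter_step_fixed.
by rewrite sumr_const card_ord mulr_natl subrr normr0.
Qed.

(** Stationarity: shifting the orbit by one step changes its partial sums only by two boundary
    terms. *)
Lemma stat_step f s : avg (stat s) (step M f) = avg (stat s) f.
Proof.
have [rho [fix_rho [c cP]]] := cesaro_bounded f.
have [b b0 bP] := exists_bound f.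
rewrite (statE (cP s)); apply: (@statE _ _ _ (c + (b + b))) => T.
have -> : \sum_(k < T) iter k (step M) (step M f) s - T%:R * rho s =
  (\sum_(k < T) iter k (step M) f s - T%:R * rho s) + (iter T (step M) f s - f s).
  elim: T => [|T IH]; first by rewrite !big_ord0 /= subrr addr0.
  rewrite !big_ord_recr /= -iterSr /= -natr1 mulrDl; lra.
apply: (le_trans (ler_normD _ _)); apply: lerD; first exact: cP.
by apply: (le_trans (ler_normB _ _)); apply: lerD; [exact: iter_avg_bound | ].
Qed.

Lemma stat_dist s : is_dist (stat s).
Proof.
split=> [s'|]; last first.
  have := @stat_fixed (fun=> 1) s (fun x => avg_cst 1 (dM x)).
  by rewrite /avg => <-; apply: eq_bigr => t _; rewrite mulr1.
have [rho [fix_rho [c cP]]] := cesaro_bounded (fun x => (x == s')%:R).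
rewrite -avg_delta (statE (cP s)); apply: (@linear_bounded_below_ge0 _ c) => T.
have := cP s T; rewrite ler_norml => /andP[_ H].
have : 0 <= \sum_(k < T) iter k (step M) (fun x => (x == s')%:R) s.
  apply: sumr_ge0 => k _; elim: (k : nat) s {H} => [|j IH] s /=; first by rewrite ler0n.
  exact: avg_ge.
lra.
Qed.

Definition stat_bias f (s : S) : R :=
  cesaro_lim (fun T => \sum_(t < T) (iter t (step M) f s - avg (stat s) f)).

(** With [f = rho + g - M g], the partial sums of [M^t f - rho] are [g - M^T g], so the bias is [g]
    minus its stationary average. Decomposing [g] in turn shows that the bias is itself a
    coboundary, which supplies the next-order term in [Vdisc_laurent]. *)
Lemma poisson_equation f :
  (forall s, f s = avg (stat s) f + stat_bias f s - step M (stat_bias f) s) /\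
  exists k, forall s, stat_bias f s = k s - step M k s.
Proof.
have [rho [g [fix_rho fE]]] := ergodic_decomposition f.
have fun_fE : f = fun s => rho s + (g s - step M g s).
  by apply/funext => t; rewrite fE addrA.
have statf s : avg (stat s) f = rho s.
  by rewrite {1}fun_fE avgD avgB stat_step stat_fixed // subrr addr0.
have biasE s : stat_bias f s = g s - avg (stat s) g.
  have [rg [_ [c cP]]] := cesaro_bounded g.
  rewrite (statE (cP s)); apply: (@cesaro_limE _ _ _ c) => T.
  rewrite -normrN; apply: le_trans (cP s T); rewrite le_eqVlt; apply/orP; left.
  apply/eqP; congr (`|_|).
  have E t : \sum_(k < t) (iter k (step M) f s - avg (stat s) f) =
      g s - iter t (step M) g s.
    elim: t => [|t IH]; first by rewrite big_ord0 subrr.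
    rewrite big_ord_recr /= IH statf fun_fE iter_stepD.
    rewrite iter_step_coboundary (iter_step_fixed _ _ fix_rho) /=; ring.
  under eq_bigr do rewrite E.
  by rewrite sumrB sumr_const card_ord -mulr_natl; ring.
split=> [s|].
  rewrite statf biasE fE /step (avg_ext (M s) biasE) avgB -/(step M _ s).
  by rewrite -/(step M (fun s => avg (stat s) g) s) stat_harmonic; ring.
have [rg [k [fix_rg gE]]] := ergodic_decomposition g.
exists k => s; rewrite biasE.
have -> : avg (stat s) g = rg s.
  have -> : g = fun s => rg s + (k s - step M k s).
    by apply/funext => t; rewrite gE addrA.
  by rewrite avgD avgB stat_step stat_fixed // subrr addr0.
by rewrite gE; ring.
Qed.

End Ergodic.

(** * Discounted values, gain and bias of a policy *)

Section PolicyEvaluation.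
Variables (R : realType) (S A : finType).
Variables (P : S -> A -> S -> R) (r : S -> A -> R).
Hypothesis kP : is_kernel P.
Implicit Types (pi : S -> A -> R) (f : S -> R).

Lemma kernel_dist s a : is_dist (P s a).
Proof. by case: kP => P0 P1; split=> [s'|]; [exact: P0 | exact: P1]. Qed.

Lemma Ppi_dist pi s : is_policy pi -> is_dist (Ppi P pi s).
Proof.
case=> pi0 pi1; split=> [s'|].
  by apply: sumr_ge0 => a _; rewrite mulr_ge0 //; case: kP.
rewrite exchange_big /= -(pi1 s); apply: eq_bigr => a _.
by rewrite -mulr_sumr; case: kP => _ ->; rewrite mulr1.
Qed.

Lemma avg_Ppi pi s f : avg (Ppi P pi s) f = \sum_a pi s a * avg (P s a) f.
Proof. exact: avg_suml. Qed.

Lemma PpowE pi t s s' :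
  Ppow P pi t s s' = iter t (step (Ppi P pi)) (fun x => (x == s')%:R) s.
Proof. by rewrite /Ppow mx_entryE fun_of_cv_pow cv_ofK. Qed.

Lemma PinfE pi s s' : Pinf P pi s s' = stat (Ppi P pi) s s'.
Proof.
by rewrite /Pinf /stat; congr cesaro_lim; apply/funext => t; exact: PpowE.
Qed.

Lemma gainE pi s : gain P r pi s = avg (stat (Ppi P pi) s) (rpi r pi).
Proof. by apply: eq_bigr => s' _; rewrite PinfE. Qed.

Lemma biasE pi s : bias P r pi s = stat_bias (Ppi P pi) (rpi r pi) s.
Proof.
rewrite /bias /stat_bias; congr cesaro_lim; apply/funext => T.
apply: eq_bigr => t _; rewrite gainE iter_stepE; congr (_ - _).
by apply: eq_bigr => s' _; rewrite PpowE mulrC.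
Qed.

Lemma VdiscE gamma pi s : is_policy pi -> 0 <= gamma < 1 ->
  Vdisc P r gamma pi s =
  rpi r pi s + gamma * avg (Ppi P pi s) (Vdisc P r gamma pi).
Proof.
move=> ppi g01; set N := 1%:M - gamma *: mx_of (Ppi P pi).
have NE v x : fun_of_cv (N *m v) x =
    fun_of_cv v x - gamma * avg (Ppi P pi x) (fun_of_cv v).
  by rewrite mulmxBl mul1mx -scalemxAl fun_of_cvB fun_of_cvZ fun_of_cv_mul.
(* [invmx] is an inverse only on units. A kernel vector satisfies [u = gamma P u], and the maximum
   principle applied to [u] and [- u] makes it zero. *)
have unitN : N \in unitmx.
  rewrite -unitmx_tr -row_free_unit -kermx_eq0; apply/rowV0P => u.
  move=> /sub_kermxP uN; have Nu : N *m u^T = 0.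
    by rewrite -[N]trmxK -trmx_mul uN trmx0.
  have E x : fun_of_cv u^T x = gamma * avg (Ppi P pi x) (fun_of_cv u^T).
    have /esym/eqP := NE u^T x.
    by rewrite Nu {3}/fun_of_cv mxE subr_eq0 => /eqP.
  have dM x := Ppi_dist x ppi.
  have le0 : forall x, fun_of_cv u^T x <= 0 / (1 - gamma).
    apply: (discounted_max_principle dM g01) => x.
    by rewrite add0r -E.
  have ge0 : forall x, - fun_of_cv u^T x <= 0 / (1 - gamma).
    apply: (discounted_max_principle (x := fun x => - fun_of_cv u^T x) dM g01).
    by move=> x; rewrite add0r avgN mulrN -E.
  apply: trmx_inj; rewrite trmx0 -[LHS]fun_of_cvK; apply/matrixP => i j.
  rewrite !mxE; apply/eqP; rewrite eq_le; apply/andP; split.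
    by have := le0 (enum_val i); rewrite mul0r.
  by rewrite -oppr_le0; have := ge0 (enum_val i); rewrite mul0r.
have := NE (invmx N *m cv_of (rpi r pi)) s.
rewrite mulKVmx // cv_ofK -/(Vdisc P r gamma pi) => ->.
by rewrite /N -/(Vdisc P r gamma pi) subrK.
Qed.

(** Comparison principle for approximate supersolutions of the evaluation equation: the maximum
    principle applied to [V - f] amplifies a one-step error by at most the horizon. *)
Lemma Vdisc_upper gamma pi f c : is_policy pi -> 0 <= gamma < 1 ->
  (forall s, rpi r pi s + gamma * avg (Ppi P pi s) f <= f s + c) ->
  forall s, Vdisc P r gamma pi s <= f s + c / (1 - gamma).
Proof.
move=> ppi g01 H s; rewrite addrC -lerBlDr.
apply: (discounted_max_principle (M := Ppi P pi)
  (x := fun s => Vdisc P r gamma pi s - f s)) => // x; first exact: Ppi_dist.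
by have := H x; have := VdiscE x ppi g01; rewrite avgB mulrBr; lra.
Qed.

Lemma Vdisc_lower gamma pi f c : is_policy pi -> 0 <= gamma < 1 ->
  (forall s, f s - c <= rpi r pi s + gamma * avg (Ppi P pi s) f) ->
  forall s, f s - c / (1 - gamma) <= Vdisc P r gamma pi s.
Proof.
move=> ppi g01 H s; rewrite lerBlDl addrC -lerBlDl.
apply: (discounted_max_principle (M := Ppi P pi)
  (x := fun s => f s - Vdisc P r gamma pi s)) => // x; first exact: Ppi_dist.
by have := H x; have := VdiscE x ppi g01; rewrite avgB mulrBr; lra.
Qed.

(** One step of policy improvement: play [a] at [s] and follow [pi] elsewhere. The old value is a
    subsolution for the new policy, hence below its value. This converts optimality among policies
    into one-step Bellman inequalities. *)
Lemma deviation_improves gamma pi s a : is_policy pi -> 0 <= gamma < 1 ->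
  Vdisc P r gamma pi s <= r s a + gamma * avg (P s a) (Vdisc P r gamma pi) ->
  exists2 pi', is_policy pi' &
    r s a + gamma * avg (P s a) (Vdisc P r gamma pi) <= Vdisc P r gamma pi' s.
Proof.
move=> ppi g01 H; set V := Vdisc P r gamma pi in H *.
pose pi' x b : R := if x == s then (b == a)%:R else pi x b.
have sum_delta (F : A -> R) : \sum_b (b == a)%:R * F b = F a.
  rewrite (bigD1 a) //= eqxx mul1r big1 ?addr0 // => b /negPf ->.
  by rewrite mul0r.
have ppi' : is_policy pi'.
  rewrite /pi'; split=> x.
    by move=> b; case: eqP => _; [exact: ler0n | case: ppi => + _; apply].
  case: eqP => [_|_]; last by case: ppi => _ ->.
  by rewrite -[RHS](sum_delta (fun=> 1)); apply: eq_bigr => b _; rewrite mulr1.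
have atsr : rpi r pi' s = r s a.
  by rewrite /rpi /pi' eqxx sum_delta.
have ats f : avg (Ppi P pi' s) f = avg (P s a) f.
  by rewrite avg_Ppi /pi' eqxx sum_delta.
have off x f : x != s ->
    rpi r pi' x = rpi r pi x /\ avg (Ppi P pi' x) f = avg (Ppi P pi x) f.
  by move=> /negPf xs; rewrite !avg_Ppi /rpi /pi' xs.
have VV' : forall x, V x <= Vdisc P r gamma pi' x.
  move=> x; have := Vdisc_lower (f := V) (c := 0) ppi' g01 _ x.
  rewrite mul0r subr0; apply => y; rewrite subr0.
  have [->|/off yE] := eqVneq y s; first by rewrite atsr ats.
  by have [-> ->] := yE V; rewrite {1}/V VdiscE.
exists pi' => //; rewrite VdiscE // atsr ats lerD2l ler_wpM2l //.
  by case/andP: g01.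
by apply: avg_mono => // s'; case: kP.
Qed.

(** Leading terms of the Laurent expansion at [gamma = 1], by comparison with an explicit
    approximate solution. The constant does not depend on [gamma], so [gamma] can later tend to
    1. *)
Lemma Vdisc_laurent pi : is_policy pi -> exists c, forall gamma, 0 <= gamma < 1 ->
  forall s, `|Vdisc P r gamma pi s - (gain P r pi s / (1 - gamma) + bias P r pi s)|
    <= c * (1 - gamma).
Proof.
move=> ppi; have dM s := Ppi_dist s ppi.
have [rE [k hE]] := poisson_equation dM (rpi r pi).
have [c c0 kc] := exists_bound k.
set h := stat_bias _ _ in rE hE.
have rhoM s := stat_harmonic dM (rpi r pi) s.
exists (c + c) => gamma g01; set M := Ppi P pi in dM rE hE rhoM *.
have [g0 g1] := andP g01; set b := 1 - gamma.
have b0 : 0 < b by rewrite subr_gt0.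
have hM s : step M h s = step M k s - step M (step M k) s.
  by rewrite -avgB; apply: avg_ext => x; exact: hE.
have cM s : `|step M k s| <= c by exact: avg_norm.
have cMM s : `|step M (step M k) s| <= c by exact: avg_norm.
(* The correction [- b M k] brings the Bellman residual down to order [b^2]. *)
pose f s := avg (stat M s) (rpi r pi) / b + h s - b * step M k s.
have fE s : rpi r pi s + gamma * avg (M s) f = f s + b ^+ 2 * step M (step M k) s.
  have -> : avg (M s) f = avg (stat M s) (rpi r pi) / b + step M h s
      - b * step M (step M k) s.
    rewrite /f avgB avgD avgZ -/(step M h s) -/(step M (step M k) s).
    have -> // : avg (M s) (fun s => avg (stat M s) (rpi r pi) / b) =
        avg (stat M s) (rpi r pi) / b.
    rewrite -rhoM mulrC -avgZ; apply: avg_ext => x; exact: mulrC.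
  rewrite {1}rE /f hM -/h.
  have -> : gamma = 1 - b by rewrite /b; ring.
  by field; rewrite gt_eqF.
have cb : b ^+ 2 * c / b = c * b by field; rewrite gt_eqF.
have bMM s : `|b ^+ 2 * step M (step M k) s| <= b ^+ 2 * c.
  by rewrite normrM ger0_norm ?sqr_ge0 // ler_wpM2l ?sqr_ge0.
have bM s : `|b * step M k s| <= c * b.
  by rewrite normrM gtr0_norm // mulrC ler_wpM2r // ltW.
move=> s; rewrite gainE biasE -/M -/h.
have up : Vdisc P r gamma pi s <= f s + c * b.
  rewrite -cb; apply: Vdisc_upper => // x; rewrite fE lerD2l.
  by have := bMM x; rewrite ler_norml => /andP[].
have lo : f s - c * b <= Vdisc P r gamma pi s.
  rewrite -cb; apply: Vdisc_lower => // x; rewrite fE lerD2l.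
  by have := bMM x; rewrite ler_norml => /andP[].
have := bM s; rewrite ler_norml => /andP[lo2 up2].
rewrite ler_norml; move: up lo; rewrite /f => up lo.
by apply/andP; split; lra.
Qed.

Lemma small_multiples_le0 (c x : R) (e : R) : 0 < e ->
  (forall b, 0 < b < e -> x <= c * b) -> x <= 0.
Proof.
move=> e0 H; rewrite leNgt; apply/negP => x0.
have c0 : 0 < c.
  have := H (e / 2) _; rewrite divr_gt0 // ltr_pdivrMr // mulrDr mulr1 ltrDl e0.
  move=> /(_ isT) /(lt_le_trans x0); rewrite pmulr_lgt0 // divr_gt0 //.
pose b := Num.min (e / 2) (x / (2 * c)).
have b0 : 0 < b by rewrite lt_min !divr_gt0 // mulr_gt0.
have be : b < e by rewrite gt_min; apply/orP; left; lra.
have := H b; rewrite b0 be => /(_ isT).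
have : c * b <= x / 2.
  have -> : x / 2 = c * (x / (2 * c)) by field; rewrite gt_eqF.
  by rewrite ler_wpM2l ?(ltW c0) // /b ge_min lexx orbT.
lra.
Qed.

(** * Optimality relations for a Blackwell-optimal policy *)

Section Blackwell.
Variable pi : S -> A -> R.
Hypothesis bpi : blackwell_optimal P r pi.
Let rho := gain P r pi.
Let h := bias P r pi.

Lemma blackwell_policy : is_policy pi. Proof. by case: bpi. Qed.

(** For [gamma] near 1 no one-step deviation improves on [pi]; inserting the Laurent expansion gives
    an inequality in powers of [b], whose orders [1 / b] and 1 are read off below. *)
Lemma blackwell_bellman : exists c e, 0 < e <= 1 /\ forall b, 0 < b < e -> forall s a,
  r s a + (1 - b) * (avg (P s a) rho / b + avg (P s a) h) <=
  rho s / b + h s + c * b.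
Proof.
case: bpi => ppi [g0 [/andP[g00 g01] opt]].
have [c cP] := Vdisc_laurent ppi.
exists (c + c), (1 - g0); split; first by rewrite subr_gt0 g01 lerBlDr lerDl.
move=> b /andP[b0 bg] s a.
have gb : 0 <= 1 - b < 1 by rewrite !(subr_ge0, ltrBlDr, ltrDl) b0 andbT; lra.
have g0b : g0 < 1 - b < 1 by case/andP: gb => _ ->; rewrite andbT; lra.
have cb : c * (1 - (1 - b)) = c * b by congr (_ * _); ring.
set V := Vdisc P r (1 - b) pi.
have VE x : `|V x - (rho x / b + h x)| <= c * b.
  have := cP _ gb x; rewrite cb.
  by have -> : 1 - (1 - b) = b by ring.
have VE1 x := ler_normlW (VE x).
have VE2 x : (rho x / b + h x) - c * b <= V x.
  by have := VE x; rewrite ler_norml => /andP[]; lra.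
have QV : r s a + (1 - b) * avg (P s a) V <= V s.
  case: (leP (V s) (r s a + (1 - b) * avg (P s a) V)) => [H|/ltW //].
  have [pi' ppi'] := deviation_improves ppi gb H.
  by move=> /le_trans; apply; exact: opt.
have PV : avg (P s a) rho / b + avg (P s a) h - c * b <= avg (P s a) V.
  have -> : avg (P s a) rho / b + avg (P s a) h - c * b =
      avg (P s a) (fun x => rho x / b + h x - c * b).
    rewrite avgB avgD avg_cst; last exact: kernel_dist.
    congr (_ + _ - _); rewrite mulrC -avgZ; apply: avg_ext => x; exact: mulrC.
  by apply: avg_mono => // x; case: kP.
have c0 : 0 <= c * b by exact: le_trans (VE s).
have := VE1 s; case/andP: gb => gb0 _.
have := ler_wpM2l gb0 PV; rewrite mulrBr.
have : (1 - b) * (c * b) <= c * b by rewrite ler_piMl //; lra.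
rewrite mulrDl; lra.
Qed.

(** Order [1 / b]: multiply by [b] and let [b] tend to 0, absorbing the [b^2] terms into the
    coefficient of [b]. *)
Lemma gain_superharmonic s a : avg (P s a) rho <= rho s.
Proof.
have [c [e [/andP[e0 e1] H]]] := blackwell_bellman.
rewrite -subr_le0.
apply: (@small_multiples_le0 (avg (P s a) rho - r s a - avg (P s a) h + h s
  + `|c| + `|avg (P s a) h|) _ e) => //.
move=> b be; have /andP[b0 b1] := be.
have := H b be s a => /(ler_wpM2r (ltW b0)).
have -> : (rho s / b + h s + c * b) * b = rho s + h s * b + c * b * b.
  by field; rewrite gt_eqF.
have -> : (r s a + (1 - b) * (avg (P s a) rho / b + avg (P s a) h)) * b =
  r s a * b + avg (P s a) rho - b * avg (P s a) rho + b * avg (P s a) h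
   - b * b * avg (P s a) h by field; rewrite gt_eqF.
have : c * b * b <= `|c| * b.
  rewrite ler_wpM2r ?(ltW b0) //; apply: le_trans (ler_norm _) _.
  by rewrite normrM (gtr0_norm b0) ler_piMr //; lra.
have : b * b * avg (P s a) h <= `|avg (P s a) h| * b.
  rewrite -mulrA mulrC ler_wpM2r ?(ltW b0) //; apply: le_trans (ler_norm _) _.
  by rewrite normrM (gtr0_norm b0) ler_piMl //; lra.
lra.
Qed.

(** Order 1: with constant gain the [1 / b] terms cancel exactly. *)
Lemma bellman_inequality c : (forall s, rho s = c) ->
  forall s a, r s a + avg (P s a) h <= c + h s.
Proof.
move=> rhoc s a; have [d [e [/andP[e0 e1] H]]] := blackwell_bellman.
rewrite -subr_le0.
apply: (@small_multiples_le0 (d + avg (P s a) h) _ e) => // b be.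
have /andP[b0 b1] := be; have := H b be s a.
have -> : avg (P s a) rho = c.
  by rewrite (avg_ext _ rhoc) avg_cst //; exact: kernel_dist.
rewrite rhoc; have -> : (1 - b) * (c / b + avg (P s a) h) =
  c / b - c + avg (P s a) h - b * avg (P s a) h by field; rewrite gt_eqF.
lra.
Qed.

End Blackwell.

(** * Transience and constancy of the optimal gain *)

(** Under the stationary distribution, the probability of avoiding [x] for [K] steps drops at each
    step by the mass of [x] times [q K x], which is at least the probability [1 - l] of never
    returning. A nonnegative quantity cannot keep dropping by a fixed positive amount. *)
Lemma transient_stat0 pi s x : is_policy pi -> transient P pi x ->
  stat (Ppi P pi) s x = 0.
Proof.
move=> ppi trx; have dM y := Ppi_dist y ppi; set M := Ppi P pi in dM *.
pose Q y z : R := if z == x then 0 else M y z.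
(* [q K y] is the probability of avoiding [x] during [K] steps from [y]. *)
pose q K := iter K (step Q) (fun=> 1).
have avgQ y f : avg (Q y) f = avg (M y) f - M y x * f x.
  rewrite /avg [X in _ = X - _](bigD1 x) //= [LHS](bigD1 x) //= /Q eqxx mul0r.
  rewrite add0r addrAC subrr add0r; apply: eq_bigr => z /negPf -> //.
have qS K y : q K.+1 y = avg (M y) (q K) - M y x * q K x.
  by rewrite /q /= /step avgQ.
have q0 K y : 0 <= q K y.
  elim: K y => [|K IH] y; first by rewrite /q /= ler01.
  rewrite /q /= /step; apply: sumr_ge0 => z _; apply: mulr_ge0; last exact: IH.
  by rewrite /Q; case: ifP => // _; case: (dM y).
(* A first return at time [K + 1] is avoidance for [K] steps but not for [K + 1]; the series then
   telescopes. *)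
have frE : forall K, first_return P pi x K = q K x - q K.+1 x.
  move=> K; rewrite /first_return mx_entryE -mulmxA fun_of_cv_pow fun_of_cv_mul cv_ofK.
  have -> : step M (fun t => (t == x)%:R) = fun y => 1 - step Q (fun=> 1) y.
    by apply/funext => y; rewrite /step avg_delta avgQ avg_cst // mulr1 subKr.
  rewrite -/M -/Q; elim: K (x) => [|K IH] y //=.
  by rewrite /step (avg_ext _ IH) avgB.
have serE K : series (first_return P pi x) K = 1 - q K x.
  rewrite /series /=; elim: K => [|K IH]; first by rewrite big_geq // subrr.
  by rewrite big_nat_recr //= IH frE addrA subrK.
have qmono K : q K.+1 x <= q K x.
  elim: K (x) => [|K IH] y; rewrite {1}/q iterS -/(q _).
    rewrite /step avgQ avg_cst // /q /= mulr1 lerBlDr lerDl.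
    by case: (dM y).
  rewrite {2}/q iterS; apply: avg_mono => // z.
  by rewrite /Q; case: ifP => // _; case: (dM y).
rewrite /transient in trx; set l := limn _ in trx.
have serm : {homo series (first_return P pi x) : n m / (n <= m)%N >-> n <= m}.
  apply/nondecreasing_seqP => K; rewrite !serE lerB //.
have serl K : series (first_return P pi x) K <= l.
  apply: nondecreasing_cvgn_le => //; apply: nondecreasing_is_cvgn => //.
  by exists 1 => _ [m _ <-]; rewrite serE lerBlDr lerDl.
have ql K : 1 - l <= q K x by have := serl K; rewrite serE; lra.
have [mu0 mu1] := stat_dist dM s.
have mux : stat M s x = avg (stat M s) (fun y => M y x).
  rewrite -avg_delta -stat_step //; apply: avg_ext => y; exact: avg_delta.
have decr K : avg (stat M s) (q K.+1) = avg (stat M s) (q K) - stat M s x * q K x.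
  rewrite (avg_ext _ (qS K)) avgB -[avg _ (fun y => avg (M y) (q K))]/(avg _ (step M (q K))).
  rewrite stat_step //; congr (_ - _).
  rewrite (@avg_ext _ _ _ _ (fun y => q K x * M y x)); last by move=> y; rewrite mulrC.
  by rewrite avgZ -mux mulrC.
have bound K : avg (stat M s) (q K) <= 1 - K%:R * (stat M s x * (1 - l)).
  elim: K => [|K IH]; first by rewrite avg_cst ?mul0r ?subr0 //; split.
  rewrite decr -natr1; have := ler_wpM2l (mu0 x) (ql K); lra.
have : stat M s x * (1 - l) = 0.
  apply: (@linear_bounded_eq0 _ 1) => K; rewrite ger0_norm.
    have : 0 <= avg (stat M s) (q K) by apply: sumr_ge0 => y _; rewrite mulr_ge0.
    by have := bound K; lra.
  by rewrite !mulr_ge0 // subr_ge0 ltW.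
by move/eqP; rewrite mulf_eq0 subr_eq0 [1 == _]eq_sym (lt_eqF trx) orbF => /eqP.
Qed.

(** Minimum principle: [M^t f - f s] is nonpositive at [s], yet it is a sum of nonnegative terms, so
    every term with positive weight vanishes. *)
Lemma superharmonic_min_reach f pi t s s' : is_policy pi ->
  (forall s a, avg (P s a) f <= f s) -> (forall x, f s <= f x) ->
  0 < Ppow P pi t s s' -> f s' = f s.
Proof.
move=> ppi sup_f min_f; rewrite PpowE; have dM y := Ppi_dist y ppi.
set M := Ppi P pi in dM *; move=> pos.
have supM y : avg (M y) f <= f y.
  rewrite avg_Ppi; case: ppi => pi0 pi1.
  rewrite -[leRHS]mul1r -(pi1 y) mulr_suml; apply: ler_sum => a _.
  by rewrite ler_wpM2l.
have itM : iter t (step M) f s <= f s.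
  elim: t s {min_f pos} => //= t IH s.
  by apply: le_trans (supM s); apply: avg_mono => //; case: (dM s).
apply/eqP; rewrite eq_le min_f andbT -subr_le0.
rewrite -(pmulr_lle0 _ pos).
apply: (@le_trans _ _ (iter t (step M) f s - f s)); last by rewrite subr_le0.
pose d (s' x : S) : R := (x == s')%:R.
have it1 : \sum_x iter t (step M) (d x) s = 1.
  have := iter_stepE M t (fun=> 1) s; rewrite iter_step_fixed //.
    by move=> ->; apply: eq_bigr => x _; rewrite mul1r.
  by move=> y; exact: avg_cst.
have -> : iter t (step M) f s - f s =
    \sum_x (f x - f s) * iter t (step M) (d x) s.
  under eq_bigr do rewrite mulrBl.
  by rewrite sumrB -mulr_sumr it1 mulr1 [in LHS]iter_stepE.
rewrite (bigD1 s') //= lerDl; apply: sumr_ge0 => x _.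
rewrite mulr_ge0 ?subr_ge0 //.
elim: t s {min_f pos itM it1} => [|t IH] s /=; first exact: ler0n.
exact: avg_ge.
Qed.

(** Stationary distributions charge only [Cl], so the global minimum of the gain is attained there.
    It spreads over [Cl] along any connecting policy, since the gain is superharmonic under every
    action, and it reaches the other states because the gain is its own stationary average. *)
Lemma gain_constant pi : blackwell_optimal P r pi -> weakly_communicating P ->
  forall s s', gain P r pi s = gain P r pi s'.
Proof.
move=> bpi [Cl [trCl comCl]]; have ppi := blackwell_policy bpi.
have dM y := Ppi_dist y ppi; set rho := gain P r pi.
suff H : forall s0 s, (forall t, rho s0 <= rho t) -> rho s = rho s0.
  move=> s s'; have [m Hm] := exists_argmax (fun x => - rho x) s.
  have mP t : rho m <= rho t by have := Hm t; rewrite lerN2.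
  by rewrite (H m s mP) (H m s' mP).
have rho_stat s : rho s = avg (stat (Ppi P pi) s) rho.
  rewrite stat_fixed // => x; rewrite /rho gainE -[RHS]stat_harmonic //.
  by apply: avg_ext => y; rewrite gainE.
have stat_out s x : x \notin Cl -> stat (Ppi P pi) s x = 0.
  by move=> xCl; apply: transient_stat0 => //; exact: trCl.
have ge_on_Cl s c : (forall x, x \in Cl -> c <= rho x) -> c <= rho s.
  move=> H; have ds := stat_dist dM s.
  rewrite rho_stat -(avg_cst c ds); apply: ler_sum => x _.
  have [xCl|xCl] := boolP (x \in Cl); last by rewrite stat_out // !mul0r.
  by rewrite ler_wpM2l ?H //; case: ds.
move=> s0 s min0.
have [m mCl mE] : exists2 m, m \in Cl & rho m = rho s0.
  have [x0 x0Cl] : exists x, x \in Cl.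
    apply: contrapT => noCl; have [_] := stat_dist dM s.
    rewrite big1; first by move/esym/eqP; rewrite oner_eq0.
    by move=> x _; apply: stat_out; apply/negP => xCl; apply: noCl; exists x.
  case: (arg_minP rho x0Cl) => m mCl Hm; exists m => //.
  by apply/eqP; rewrite eq_le min0 andbT; apply: ge_on_Cl.
have constCl x : x \in Cl -> rho x = rho s0.
  move=> xCl; have [pi' [ppi' [t pos]]] := comCl m x mCl xCl; rewrite -mE.
  apply: superharmonic_min_reach pos => //; last by move=> y; rewrite mE.
  exact: gain_superharmonic.
rewrite rho_stat; have ds := stat_dist dM s.
rewrite -[RHS](avg_cst _ ds); apply: eq_bigr => x _.
have [xCl|xCl] := boolP (x \in Cl); first by rewrite constCl.
by rewrite stat_out // !mul0r.
Qed.

End PolicyEvaluation.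

(** * The span seminorm *)

Section Oscillation.
Variables (R : realType) (S : finType).
Implicit Types f : S -> R.

Lemma le_sp_norm f s t : f s - f t <= sp_norm f.
Proof.
have [c _ fc] := exists_bound f; rewrite /sp_norm lerB //.
  apply: ub_le_sup; last by exists s.
  by exists c => _ [x _ <-]; exact: le_trans (ler_norm _) (fc x).
apply: ge_inf; last by exists t.
by exists (- c) => _ [x _ <-]; have := fc x; rewrite ler_norml => /andP[].
Qed.

Lemma sp_norm_le f d (s0 : S) : (forall s t, f s - f t <= d) -> sp_norm f <= d.
Proof.
move=> H; have [m Hm] := exists_argmax f s0.
have [m' Hm'] := exists_argmax (fun s => - f s) s0.
apply: le_trans (H m m'); rewrite /sp_norm lerB //.
  by apply: ge_sup; [exists (f s0), s0 | move=> _ [x _ <-]].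
apply: lb_le_inf; first by exists (f s0), s0.
by move=> _ [x _ <-]; rewrite -lerN2.
Qed.

End Oscillation.

(** * Concentration of sample means *)

Section Concentration.
Variables (R : realType) (S : finType) (n : nat).
Implicit Types (p f : S -> R) (v : n.-tuple S).

Lemma sum_tuple_prod (g : S -> R) :
  \sum_(v : n.-tuple S) \prod_(i < n) g (tnth v i) = (\sum_s g s) ^+ n.
Proof.
rewrite -[in RHS](card_ord n) -prodr_const bigA_distr_bigA /=.
rewrite (reindex (fun v : n.-tuple S => [ffun i => tnth v i])) /=.
  by apply: eq_bigr => v _; apply: eq_bigr => i _; rewrite ffunE.
exists (fun u : {ffun 'I_n -> S} => [tuple u i | i < n]) => u _.
  by apply: eq_from_tnth => i; rewrite tnth_mktuple ffunE.
by apply/ffunP => i; rewrite ffunE tnth_mktuple.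
Qed.

Definition iid p v : R := \prod_(i < n) p (tnth v i).

Lemma iid_ge0 p v : is_dist p -> 0 <= iid p v.
Proof. by case=> p0 _; apply: prodr_ge0 => i _. Qed.

Lemma sum_iid p : is_dist p -> \sum_v iid p v = 1.
Proof. by case=> _ p1; rewrite sum_tuple_prod p1 expr1n. Qed.

(** From [exp (- x) >= 1 - x] one gets [exp x <= 1 / (1 - x)], which the quadratic dominates for
    [x <= 1/2]. *)
Lemma expR_le_quadratic (x : R) : x <= 1 / 2 -> expR x <= 1 + x + 2 * x ^+ 2.
Proof.
move=> x2; have := expR_ge1Dx (- x); rewrite expRN => H.
have e0 := expR_gt0 x.
have : (1 - x) * expR x <= 1 by rewrite -ler_pdivlMr // div1r.
have : 1 <= (1 - x) * (1 + x + 2 * x ^+ 2).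
  have -> : (1 - x) * (1 + x + 2 * x ^+ 2) = 1 + x ^+ 2 * (1 - 2 * x) by ring.
  by rewrite lerDl mulr_ge0 ?sqr_ge0 //; lra.
have x0 : 0 < 1 - x by lra.
by move=> /[swap] /le_trans /[apply]; rewrite ler_pM2l.
Qed.

Lemma chernoff p (x : S -> R) (b : R) : is_dist p -> avg p x = 0 ->
  (forall s, `|x s| <= 1) -> 0 <= b <= 1 ->
  \sum_v iid p v * (n%:R * b < \sum_(i < n) x (tnth v i))%R%:R <=
  expR (- (n%:R * b ^+ 2 / 8)).
Proof.
(* This tilt minimizes the exponent [2 th^2 - th b], with minimum [- b^2 / 8]. *)
move=> dp px0 x1 /andP[b0 b1]; pose th := b / 4.
have th0 : 0 <= th by rewrite divr_ge0.
apply: (@le_trans _ _ (\sum_v (\prod_(i < n) (p (tnth v i) * expR (th * x (tnth v i))))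
    * expR (- (th * (n%:R * b))))).
  apply: ler_sum => v _; rewrite big_split /= -/(iid p v) -mulrA.
  rewrite ler_wpM2l ?iid_ge0 //; case: ltP => /= [H|_]; last first.
    by rewrite mulr_ge0 ?expR_ge0 // prodr_ge0 // => i _; rewrite expR_ge0.
  rewrite -expR_sum -expRD -mulr_sumr -mulrBr -[leLHS]expR0 ler_expR.
  by rewrite mulr_ge0 // subr_ge0 ltW.
rewrite -mulr_suml (sum_tuple_prod (fun s => p s * expR (th * x s))).
have mgf : \sum_s p s * expR (th * x s) <= expR (2 * th ^+ 2).
  apply: (@le_trans _ _ (avg p (fun s => 1 + 2 * th ^+ 2 + th * x s))).
    apply: avg_mono => [|s]; first by case: dp.
    have x1s := x1 s; have /andP[_ xs] : -1 <= x s <= 1 by rewrite -ler_norml.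
    have thx : th * x s <= th by rewrite ler_piMr.
    have th2 : th <= 1 / 2 by rewrite /th; lra.
    apply: (le_trans (expR_le_quadratic (le_trans thx th2))).
    rewrite addrAC lerD2r lerD2l ler_wpM2l // exprMn ler_piMr ?sqr_ge0 //.
    by rewrite -real_normK ?num_real // expr_le1.
  by rewrite avgD avgZ px0 mulr0 addr0 avg_cst // expR_ge1Dx.
apply: (@le_trans _ _ (expR (2 * th ^+ 2) ^+ n * expR (- (th * (n%:R * b))))).
  rewrite ler_wpM2r ?expR_ge0 // lerXn2r ?nnegrE ?expR_ge0 //.
  by apply: sumr_ge0 => s _; rewrite mulr_ge0 ?expR_ge0 //; case: dp.
rewrite -expRM_natl -expRD ler_expR /th; lra.
Qed.

Definition sample_mean v f : R := (\sum_(i < n) f (tnth v i)) / n%:R.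

Lemma sample_mean_deviation p f (b : R) : is_dist p -> (0 < n)%N -> 0 <= b <= 1 ->
  \sum_v iid p v * (sp_norm f * b < `|avg p f - sample_mean v f|)%R%:R <=
  2 * expR (- (n%:R * b ^+ 2 / 8)).
Proof.
move=> dp n0 b01; have [b0 _] := andP b01.
have n0R : 0 < n%:R :> R by rewrite ltr0n.
set d := sp_norm f; have fd s t : f s - f t <= d by exact: le_sp_norm.
have fcd s : `|f s - avg p f| <= d.
  have -> : f s - avg p f = avg p (fun t => f s - f t) by rewrite avgB avg_cst.
  apply: avg_norm => // t; rewrite ler_norml fd andbT lerNl opprB; exact: fd.
have meanE v : avg p f - sample_mean v f =
    - ((\sum_(i < n) (f (tnth v i) - avg p f)) / n%:R).
  rewrite sumrB sumr_const card_ord -mulr_natl /sample_mean.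
  by field; rewrite gt_eqF.
(* Normalizing by the span requires it to be positive; a function of span zero never deviates, and
   the event is a strict inequality. *)
have [d0|d0] := leP d 0.
  rewrite big1 ?mulr_ge0 ?expR_ge0 // => v _; rewrite meanE big1 => [|i _].
    rewrite mul0r oppr0 normr0 ltNge; suff -> : d = 0 by rewrite mul0r lexx mulr0.
    apply/eqP; rewrite eq_le d0 /=.
    exact: le_trans (normr_ge0 _) (fcd (tnth v (Ordinal n0))).
  by apply/eqP; rewrite -normr_le0; exact: le_trans (fcd _) d0.
pose x s := (f s - avg p f) / d.
have px : avg p x = 0.
  rewrite (@avg_ext _ _ _ _ (fun s => d^-1 * (f s - avg p f))); last first.
    by move=> s; rewrite mulrC.
  by rewrite avgZ avgB avg_cst // subrr mulr0.
have x1 s : `|x s| <= 1.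
  by rewrite normrM normfV (gtr0_norm d0) ler_pdivrMr // mul1r.
have px' : avg p (fun s => - x s) = 0 by rewrite avgN px oppr0.
have x1' s : `|- x s| <= 1 by rewrite normrN.
have := lerD (chernoff dp px x1 b01) (chernoff dp px' x1' b01).
rewrite -mulr2n -[leRHS]mulr_natl => C2; apply: le_trans C2; rewrite -big_split /=.
apply: ler_sum => v _; rewrite -mulrDr ler_wpM2l ?iid_ge0 //.
case: (ltP (d * b)) => [H|_]; last by rewrite addr_ge0.
suff /orP[->|->] : (n%:R * b < \sum_(i < n) x (tnth v i)) ||
    (n%:R * b < \sum_(i < n) - x (tnth v i)).
- by rewrite lerDl.
- by rewrite lerDr.
move: H; rewrite meanE normrN.
have -> : (\sum_(i < n) (f (tnth v i) - avg p f)) / n%:R =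
    d / n%:R * \sum_(i < n) x (tnth v i).
  by rewrite /x -mulr_suml; field; rewrite !gt_eqF.
rewrite sumrN normrM gtr0_norm ?divr_gt0 // -mulrA ltr_pM2l // ltr_pdivlMl //.
by rewrite ltr_normr.
Qed.

End Concentration.

(** * The sampling measure and independence across pairs *)

Section LeaveOneOut.
Variables (R : realType) (S A : finType) (n : nat) (P : S -> A -> S -> R).
Hypothesis kP : is_kernel P.
Local Notation sample := {ffun S * A -> n.-tuple S}.
Implicit Types (w : sample) (sa : S * A).

Lemma sample_probE w : sample_prob P n w = \prod_sa iid (P sa.1 sa.2) (w sa).
Proof. by []. Qed.

Lemma sample_prob_ge0 w : 0 <= sample_prob P n w.
Proof.
by rewrite sample_probE prodr_ge0 // => sa _; apply: iid_ge0; exact: kernel_dist.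
Qed.

Lemma sum_sample_prob : \sum_w sample_prob P n w = 1.
Proof.
rewrite -(bigA_distr_bigA (fun sa v => iid (P sa.1 sa.2) v)) /=.
by rewrite big1 // => sa _; apply: sum_iid; exact: kernel_dist.
Qed.

Lemma ProbE (E : sample -> Prop) :
  Prob P n E = \sum_w sample_prob P n w * `[< E w >]%:R.
Proof.
rewrite /Prob big_mkcond; apply: eq_bigr => w _.
by case: asboolP => _; rewrite ?mulr1 ?mulr0.
Qed.

Lemma Prob_union (I : finType) (E : I -> sample -> Prop) (F : sample -> Prop) :
  (forall w, F w -> exists i, E i w) -> Prob P n F <= \sum_i Prob P n (E i).
Proof.
move=> FE; under eq_bigr do rewrite ProbE.
rewrite ProbE exchange_big; apply: ler_sum => w _ /=; rewrite -mulr_sumr.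
rewrite ler_wpM2l ?sample_prob_ge0 //; case: asboolP => [/FE [i Ei]|_].
  by rewrite (bigD1 i) //= asboolT // lerDl sumr_ge0.
exact: sumr_ge0.
Qed.

Lemma Prob_compl_ge (E F : sample -> Prop) :
  (forall w, ~ F w -> E w) -> 1 - Prob P n F <= Prob P n E.
Proof.
move=> FE; rewrite -sum_sample_prob lerBlDr !ProbE -big_split /=.
apply: ler_sum => w _; rewrite -mulrDr ler_peMr ?sample_prob_ge0 //.
case: (asboolP (F w)) => [_|/FE Ew]; first by rewrite lerDr.
by rewrite asboolT // lerDl.
Qed.

(* Exchanges the sample at [sa] with an independent copy [u.2]; this preserves the
   product measure. *)
Definition resample sa (u : sample * n.-tuple S) : sample * n.-tuple S :=
  ([ffun x => if x == sa then u.2 else u.1 x], u.1 sa).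

Lemma resampleK sa : involutive (resample sa).
Proof.
case=> w v; rewrite /resample /= ffunE eqxx; congr (_, _).
by apply/ffunP => x; rewrite !ffunE; case: eqP => [->|].
Qed.

Lemma resample_prob sa w v :
  sample_prob P n (resample sa (w, v)).1 * iid (P sa.1 sa.2) (w sa) =
  sample_prob P n w * iid (P sa.1 sa.2) v.
Proof.
rewrite !sample_probE (bigD1 sa) //= [in RHS](bigD1 sa) //= ffunE eqxx.
rewrite (eq_bigr (fun x => iid (P x.1 x.2) (w x))); first by ring.
by move=> x /negPf xsa; rewrite ffunE xsa.
Qed.

(** The hypothesis says that [phi] sees [w] only off [sa], so the sample at [sa] may be replaced by
    an independent copy and integrated out first. *)
Lemma sum_resample sa (phi : sample -> n.-tuple S -> R) :
  (forall w v v', phi (resample sa (w, v)).1 v' = phi w v') ->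
  \sum_w sample_prob P n w * phi w (w sa) =
  \sum_w sample_prob P n w * \sum_v iid (P sa.1 sa.2) v * phi w v.
Proof.
move=> phiE; pose G (u : sample * n.-tuple S) :=
  sample_prob P n u.1 * iid (P sa.1 sa.2) u.2 * phi u.1 (u.1 sa).
transitivity (\sum_u G u).
  rewrite -(pair_bigA _ (fun w v => G (w, v))) /=; apply: eq_bigr => w _.
  rewrite /G /= -mulr_suml -mulr_sumr sum_iid ?mulr1 //; exact: kernel_dist.
rewrite (reindex_inj (inv_inj (resampleK sa))) /=.
rewrite -(pair_bigA _ (fun w v => G (resample sa (w, v)))) /=.
apply: eq_bigr => w _; rewrite mulr_sumr; apply: eq_bigr => v _.
rewrite /G resample_prob phiE /= ffunE eqxx; ring.
Qed.

Lemma avg_Phat w s a f : avg (Phat n w s a) f = sample_mean (w (s, a)) f :> R.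
Proof.
rewrite /avg /Phat /sample_mean mulr_suml.
have cE s' : (count (pred1 s') (w (s, a)))%:R =
    \sum_(i < n) (tnth (w (s, a)) i == s')%:R :> R.
  rewrite -sum1_count big_tuple big_mkcond natr_sum; apply: eq_bigr => i _ /=.
  by case: eqP.
under eq_bigr do rewrite cE !mulr_suml.
rewrite exchange_big; apply: eq_bigr => i _ /=.
rewrite (bigD1 (tnth (w (s, a)) i)) //= eqxx mul1r mulrC big1 ?addr0 // => x.
by rewrite eq_sym => /negPf ->; rewrite !mul0r.
Qed.

Lemma Phat_kernel w : (0 < n)%N -> is_kernel (@Phat R S A n w).
Proof.
move=> n0; split=> [s a s'|s a]; first by rewrite divr_ge0.
have := avg_Phat w s a (fun=> 1); rewrite /sample_mean sumr_const card_ord.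
rewrite divff ?pnatr_eq0 -?lt0n // => <-.
by apply: eq_bigr => s' _; rewrite mulr1.
Qed.

(** Given the samples of the other pairs, [F w] is a fixed function, and the deviation bound applies
    with its own span as scale. *)
Lemma leave_one_out_deviation s a (b : R) (F : sample -> S -> R) :
  (0 < n)%N -> 0 <= b <= 1 ->
  (forall w w', (forall x, x != (s, a) -> w x = w' x) -> F w = F w') ->
  Prob P n (fun w => sp_norm (F w) * b <
    `|avg (P s a) (F w) - avg (Phat n w s a) (F w)|) <=
  2 * expR (- (n%:R * b ^+ 2 / 8)).
Proof.
move=> n0 b01 FE; rewrite ProbE.
under eq_bigr do rewrite asboolb avg_Phat.
rewrite (sum_resample (sa := (s, a)) (phi := fun w v =>
  (sp_norm (F w) * b < `|avg (P s a) (F w) - sample_mean v (F w)|)%R%:R)); last first.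
  move=> w v v'; suff -> : F (resample (s, a) (w, v)).1 = F w by [].
  by apply: FE => x /negPf xsa; rewrite ffunE xsa.
rewrite -[leRHS]mul1r -[X in _ <= X * _]sum_sample_prob mulr_suml.
apply: ler_sum => w _.
rewrite ler_wpM2l ?sample_prob_ge0 //. apply: sample_mean_deviation => //.
exact: kernel_dist.
Qed.

End LeaveOneOut.

(** * The Bellman optimality operator *)

Section Bellman.
Variables (R : realType) (S A : finType).
Variables (gamma : R) (u : S -> A -> R) (K : S -> A -> S -> R).
Implicit Types f g : S -> R.

(* The values maximized below are nonnegative, so [0] is a harmless default. *)
Definition bellman f (s : S) : R :=
  \big[Num.max/0]_a (u s a + gamma * avg (K s a) f).

Lemma bellman_ge f s a : u s a + gamma * avg (K s a) f <= bellman f s.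
Proof. exact: (le_bigmax _ (fun a => u s a + gamma * avg (K s a) f)). Qed.

Lemma bellman_ge0 f s : 0 <= bellman f s.
Proof. exact: bigmax_ge_id. Qed.

Lemma bellman_le f s c : 0 <= c ->
  (forall a, u s a + gamma * avg (K s a) f <= c) -> bellman f s <= c.
Proof. by move=> c0 H; apply: bigmax_le => // a _. Qed.

Hypothesis g01 : 0 <= gamma < 1.
(** Weaker than being a kernel, so as to cover the leave-one-out kernel, which has a zero row. *)
Hypothesis K_nonexpansive : forall s a f c, 0 <= c ->
  (forall x, `|f x| <= c) -> `|avg (K s a) f| <= c.

Lemma bellman_contraction f g c : 0 <= c -> (forall s, `|f s - g s| <= c) ->
  forall s, `|bellman f s - bellman g s| <= gamma * c.
Proof.
move=> c0 fgc s; have [g0 _] := andP g01.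
have half f1 f2 : (forall s, `|f1 s - f2 s| <= c) ->
    bellman f1 s <= bellman f2 s + gamma * c.
  move=> H; apply: bellman_le => [|a]; first by rewrite addr_ge0 ?bellman_ge0 ?mulr_ge0.
  apply: (@le_trans _ _ (u s a + gamma * avg (K s a) f2 + gamma * c)).
    rewrite -addrA lerD2l -mulrDr ler_wpM2l // -lerBlDl -avgB.
    by apply: le_trans (ler_norm _) _; exact: K_nonexpansive.
  by rewrite lerD2r bellman_ge.
rewrite ler_norml; apply/andP; split; last by rewrite lerBlDl; exact: half.
by rewrite lerNl opprB lerBlDl; apply: half => x; rewrite distrC.
Qed.

Lemma iter_bellman_contraction k f g c : 0 <= c -> (forall s, `|f s - g s| <= c) ->
  forall s, `|iter k bellman f s - iter k bellman g s| <= gamma ^+ k * c.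
Proof.
move=> c0 fgc; elim: k => [|k IH] s; first by rewrite expr0 mul1r.
rewrite exprS -mulrA /=; apply: bellman_contraction => //.
by rewrite mulr_ge0 // exprn_ge0 //; case/andP: g01.
Qed.

Lemma iter_bellman_approx k f e : (forall s, `|f s - bellman f s| <= e) ->
  forall s, `|f s - iter k bellman f s| <= e / (1 - gamma).
Proof.
move=> fe; have [g0 g1] := andP g01; have b0 : 0 < 1 - gamma by rewrite subr_gt0.
elim: k => [|k IH] s /=.
  by rewrite subrr normr0 divr_ge0 ?(ltW b0) //; exact: le_trans (fe s).
have e0 : 0 <= e by exact: le_trans (fe s).
have -> : e / (1 - gamma) = e + gamma * (e / (1 - gamma)) by field; rewrite gt_eqF.
rewrite -(subrKA (bellman f s)); apply: (le_trans (ler_normD _ _)); apply: lerD => //.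
by apply: bellman_contraction => //; rewrite divr_ge0 // ltW.
Qed.

End Bellman.

(** * Values with one frozen backup *)

Section LeaveOneOutValue.
Variables (R : realType) (S A : finType).
Variables (gamma : R) (r : S -> A -> R).

Definition loo_reward (sa : S * A) (c : R) (s : S) (a : A) : R :=
  if (s, a) == sa then c else r s a.

Definition loo_kernel (sa : S * A) (K : S -> A -> S -> R) (s : S) (a : A) : S -> R :=
  if (s, a) == sa then fun=> 0 else K s a.

Definition loo_value (k : nat) (sa : S * A) (c : R) (K : S -> A -> S -> R) : S -> R :=
  iter k (bellman gamma (loo_reward sa c) (loo_kernel sa K)) (fun=> 0).

Variable K : S -> A -> S -> R.
Hypothesis kK : is_kernel K.
Hypothesis g01 : 0 < gamma < 1.
Let b := 1 - gamma.

Lemma loo_kernel_nonexpansive sa s a f c : 0 <= c ->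
  (forall x, `|f x| <= c) -> `|avg (loo_kernel sa K s a) f| <= c.
Proof.
move=> c0 fc; rewrite /loo_kernel; case: eqP => _.
  by rewrite /avg big1 ?normr0 // => x _; rewrite mul0r.
by apply: avg_norm => //; exact: kernel_dist.
Qed.

(* Freezing the Bellman backup of the pair at [c] removes the kernel at that pair
   and almost preserves the fixed point. *)
Lemma loo_value_approx k s0 a0 c V e e' :
  (forall s, `|V s - bellman gamma r K V s| <= e) ->
  `|c - (r s0 a0 + gamma * avg (K s0 a0) V)| <= e' ->
  (forall s, 0 <= V s <= b^-1) -> gamma ^+ k <= b ^+ 2 ->
  forall s, `|V s - loo_value k (s0, a0) c K s| <= (e + e') / b + b.
Proof.
move=> Ve ce V01 gk s; have [/ltW g0 g1] := andP g01.
have g01' : 0 <= gamma < 1 by rewrite g0.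
have b0 : 0 < b by rewrite subr_gt0.
have bi0 : 0 <= b^-1 by rewrite invr_ge0 ltW.
set B := bellman gamma (loo_reward (s0, a0) c) (loo_kernel (s0, a0) K).
have KN s1 a1 f1 c1 := @loo_kernel_nonexpansive (s0, a0) s1 a1 f1 c1.
have e'0 : 0 <= e' by exact: le_trans ce.
have [ce1 ce2] : - e' <= c - (r s0 a0 + gamma * avg (K s0 a0) V) /\
    c - (r s0 a0 + gamma * avg (K s0 a0) V) <= e' by apply/andP; rewrite -ler_norml.
have looE x a : loo_reward (s0, a0) c x a + gamma * avg (loo_kernel (s0, a0) K x a) V =
    if (x, a) == (s0, a0) then c else r x a + gamma * avg (K x a) V.
  rewrite /loo_reward /loo_kernel; case: eqP => // _.
  by rewrite /avg big1 ?mulr0 ?addr0 // => y _; rewrite mul0r.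
have close x : `|V x - B V x| <= e + e'.
  rewrite -(subrKA (bellman gamma r K V x)); apply: (le_trans (ler_normD _ _)).
  apply: lerD => //; rewrite ler_norml; apply/andP; split.
    rewrite lerBrDl lerBlDr; apply: bellman_le => [|a].
      by rewrite addr_ge0 ?bellman_ge0.
    rewrite looE; case: eqP => [[-> _]|_].
      by have := bellman_ge gamma r K V s0 a0; lra.
    by have := bellman_ge gamma r K V x a; lra.
  rewrite lerBlDl; apply: bellman_le => [|a]; first by rewrite addr_ge0 ?bellman_ge0.
  have := bellman_ge gamma (loo_reward (s0, a0) c) (loo_kernel (s0, a0) K) V x a.
  by rewrite looE -/B; case: eqP => [[-> ->]|_]; lra.
rewrite -(subrKA (iter k B V s)); apply: (le_trans (ler_normD _ _)); apply: lerD.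
  exact: (iter_bellman_approx g01' KN).
(* Truncation error: [V] is within [1 / b] of the starting function 0, and [gamma^k <= b^2] leaves
   [b]. *)
apply: (@le_trans _ _ (gamma ^+ k * b^-1)).
  apply: (iter_bellman_contraction _ g01' KN) => // x.
  by rewrite subr0 ger0_norm; have /andP[] := V01 x.
by rewrite ler_pdivrMr // -expr2.
Qed.

End LeaveOneOutValue.

(** * Deterministic analysis on the good event *)

Section EmpiricalPlanning.
Variables (R : realType) (S A : finType).
Variables (P Ph : S -> A -> S -> R) (r : S -> A -> R).
Hypothesis (kP : is_kernel P) (kPh : is_kernel Ph).
Hypothesis r01 : forall s a, 0 <= r s a <= 1.
Variable b : R.
Hypothesis b01 : 0 < b < 1.
Let gamma := 1 - b.

Let g01 : 0 <= gamma < 1.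
Proof. by rewrite /gamma; case/andP: b01 => b0 b1; apply/andP; split; lra. Qed.

Let b_gamma : 1 - gamma = b. Proof. by rewrite /gamma; ring. Qed.

Lemma rpi_bounds pi s : is_policy pi -> 0 <= rpi r pi s <= 1.
Proof.
case=> pi0 pi1; apply/andP; split.
  by apply: sumr_ge0 => a _; rewrite mulr_ge0 //; case/andP: (r01 s a).
rewrite -(pi1 s); apply: ler_sum => a _; rewrite ler_piMr //.
by case/andP: (r01 s a).
Qed.

Lemma Vdisc_bounds pi s : is_policy pi -> 0 <= Vdisc Ph r gamma pi s <= b^-1.
Proof.
move=> ppi; apply/andP; split.
  have := Vdisc_lower (f := fun=> 0) (c := 0) kPh ppi g01 _ s.
  rewrite mul0r subr0; apply => x; rewrite ?subr0 avg_cst ?mulr0 ?addr0.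
    by case/andP: (rpi_bounds x ppi).
  exact: Ppi_dist.
have := Vdisc_upper (f := fun=> 0) (c := 1) kPh ppi g01 _ s.
rewrite b_gamma !add0r div1r; apply => x; rewrite ?add0r avg_cst ?mulr0 ?addr0.
  by case/andP: (rpi_bounds x ppi).
exact: Ppi_dist.
Qed.

Lemma Vdisc_le_Vopt pi s : is_policy pi -> Vdisc Ph r gamma pi s <= Vopt Ph r gamma s.
Proof.
move=> ppi; apply: ub_le_sup; last by exists pi.
by exists b^-1 => _ [pi' ppi' <-]; case/andP: (Vdisc_bounds s ppi').
Qed.

Variables (pistar : S -> A -> R) (rho : R) (h : S -> R).
Hypothesis ppistar : is_policy pistar.
Hypothesis bellman_h : forall s a, r s a + avg (P s a) h <= rho + h s.
Hypothesis poisson_h :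
  forall s, rho + h s = rpi r pistar s + avg (Ppi P pistar s) h.

Variables (n k : nat).
Hypothesis n0 : (0 < n)%N.
Hypothesis nb : n%:R^-1 <= b ^+ 2.
Hypothesis kb : gamma ^+ k <= b ^+ 2.

(** The two concentration hypotheses form the good event. They precede [pihat], so one event covers
    all near-optimal policies. *)
Hypothesis concentration_h : forall s a,
  `|avg (P s a) h - avg (Ph s a) h| <= sp_norm h * b.
Hypothesis concentration_loo : forall s a (j : nat), (j <= n ^ 2)%N ->
  let W := loo_value gamma r k (s, a) (j%:R / n%:R) Ph in
  `|avg (P s a) W - avg (Ph s a) W| <= sp_norm W * b.

Variable pihat : S -> A -> R.
Hypothesis ppihat : is_policy pihat.
Hypothesis near_optimal : forall s,
  Vopt Ph r gamma s - n%:R^-1 <= Vdisc Ph r gamma pihat s.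

Let V := Vdisc Ph r gamma pihat.
Let H := sp_norm h.

Let invn_bounds : 0 < n%:R^-1 :> R /\ n%:R^-1 <= 1 :> R.
Proof. by rewrite invr_gt0 ltr0n n0 invf_le1 ?ltr0n // ler1n. Qed.

(** A backup above [V s] is dominated by the value of some policy, hence by [Vopt], which exceeds
    [V s] by at most [1 / n]. *)
Lemma near_optimal_backup s a : r s a + gamma * avg (Ph s a) V <= V s + n%:R^-1.
Proof.
have [inv0 _] := invn_bounds.
case: (leP (V s) (r s a + gamma * avg (Ph s a) V)) => [le_VQ|/ltW lt_QV].
  have [pi' ppi' /le_trans] := deviation_improves kPh ppihat g01 le_VQ.
  by apply; rewrite -lerBlDr; apply: le_trans (near_optimal s); rewrite lerD2r Vdisc_le_Vopt.
by apply: le_trans lt_QV _; rewrite lerDl ltW.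
Qed.

Lemma near_optimal_residual s : `|V s - bellman gamma r Ph V s| <= n%:R^-1.
Proof.
have [inv0 _] := invn_bounds; have [V0 _] := andP (Vdisc_bounds s ppihat).
rewrite ler_norml lerBrDl lerBlDr lerBlDl; apply/andP; split.
  apply: bellman_le; first by rewrite addr_ge0 // ltW.
  by move=> a; exact: near_optimal_backup.
apply: (@le_trans _ _ (bellman gamma r Ph V s)); last by rewrite lerDl ltW.
rewrite {1}/V VdiscE // avg_Ppi /rpi mulr_sumr -big_split /=.
have [pi0 pi1] := ppihat; rewrite -[leRHS]mul1r -(pi1 s) mulr_suml.
apply: ler_sum => a _; rewrite mulrCA -mulrDr ler_wpM2l //.
exact: bellman_ge.
Qed.

Section Sandwich.
Variable m : S.
Hypothesis m_min : forall s, h m <= h s.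
(** Subtracting the minimum gives the discounting term [- b (P h - h m)] a sign: favourable in the
    upper bound, at most [b H] in size in the lower one. *)
Let v s := rho / b + (h s - h m).

Let h_range s : 0 <= h s - h m <= H.
Proof. by rewrite subr_ge0 m_min le_sp_norm. Qed.

Let avg_v p : is_dist p -> avg p v = rho / b + (avg p h - h m).
Proof. by move=> dp; rewrite /v avgD avgB !avg_cst. Qed.

Lemma V_upper s : V s <= v s + H.
Proof.
have [b0 b1] := andP b01.
have -> : H = H * b / (1 - gamma) by rewrite b_gamma mulfK ?gt_eqF.
apply: Vdisc_upper => // x; rewrite avg_Ppi /rpi mulr_sumr -big_split /=.
have [pi0 pi1] := ppihat; rewrite -[leRHS]mul1r -(pi1 x) mulr_suml.
apply: ler_sum => a _; rewrite mulrCA -mulrDr ler_wpM2l //.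
rewrite avg_v; last exact: kernel_dist.
have := concentration_h x a; rewrite -/H ler_norml => /andP[lo _].
have := bellman_h x a; have : 0 <= avg (P x a) h - h m.
  by rewrite subr_ge0 avg_ge //; exact: kernel_dist.
move: (avg (P x a) h) (avg (Ph x a) h) lo => p q lo.
have [g0 _] := andP g01; have := ler_wpM2l g0 lo.
have := ler_wpM2l (ltW b0) (ltW b0); have H0 : 0 <= H * b.
  by case/andP: (h_range x) => A1 A2; rewrite mulr_ge0 ?(ltW b0) //; exact: le_trans A1 A2.
move=> _ K1 K2 K3.
have K4 : gamma * (H * b) <= H * b by rewrite ler_piMl //; case/andP: g01 => _ /ltW.
have K5 : 0 <= b * (p - h m) by rewrite mulr_ge0 // ltW.
have -> : gamma * (rho / b + (q - h m)) =
    rho / b - rho + gamma * (q - p) + (p - h m) - b * (p - h m).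
  by rewrite /gamma; field; rewrite gt_eqF.
by rewrite /v; move: K1; rewrite mulrBr mulrN; lra.
Qed.

(** [pistar] is the competitor: concentration and discounting each cost [H b] per step, so [2 H]
    over the horizon, and the slack [1 / n] is at most 1. *)
Lemma V_lower s : v s - (2 * H + 1) <= V s.
Proof.
have [b0 b1] := andP b01; have [_ inv1] := invn_bounds.
have [g0 /ltW g1] := andP g01.
suff : v s - 2 * H <= Vdisc Ph r gamma pistar s.
  have := Vdisc_le_Vopt s ppistar; have := near_optimal s; rewrite -/V; lra.
have -> : 2 * H = 2 * H * b / (1 - gamma) by rewrite b_gamma mulfK ?gt_eqF.
apply: Vdisc_lower => // x; rewrite avg_v; last exact: Ppi_dist.
have [pi0 pi1] := ppistar.
have conc : avg (Ppi P pistar x) h - H * b <= avg (Ppi Ph pistar x) h.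
  rewrite !avg_Ppi -[H * b]mul1r -(pi1 x) mulr_suml -sumrB.
  apply: ler_sum => a _; rewrite -mulrBr ler_wpM2l //.
  by have := concentration_h x a; rewrite -/H ler_norml => /andP[_]; lra.
have dPx := Ppi_dist kP x ppistar.
have up : avg (Ppi P pistar x) h - h m <= H.
  rewrite -(avg_cst (h m) dPx) -avgB; apply: avg_le => // y.
  by case/andP: (h_range y).
have := poisson_h x; move: (avg (Ppi P pistar x) h) (avg (Ppi Ph pistar x) h) conc up.
move=> p q conc up poi.
have H0 : 0 <= H * b.
  by case/andP: (h_range x) => A1 A2; rewrite mulr_ge0 ?(ltW b0) //; exact: le_trans A1 A2.
have K4 : gamma * (H * b) <= H * b by rewrite ler_piMl.
have K5 : b * (p - h m) <= b * H by rewrite ler_wpM2l // ltW.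
have -> : gamma * (rho / b + (q - h m)) =
    rho / b - rho + gamma * (q - p) + (p - h m) - b * (p - h m).
  by rewrite /gamma; field; rewrite gt_eqF.
have : gamma * (p - q) <= gamma * (H * b) by rewrite ler_wpM2l //; lra.
rewrite /v; lra.
Qed.

End Sandwich.

Lemma empirical_value_concentration s a :
  `|avg (P s a) V - avg (Ph s a) V| <= (4 * H + 13) * b.
Proof.
have [b0 b1] := andP b01; have [g0 g1] := andP g01; have [inv0 inv1] := invn_bounds.
have [m' Hm'] := exists_argmax (fun x => - h x) s.
have m_min x : h m' <= h x by rewrite -lerN2.
have nR : 0 < n%:R :> R by rewrite ltr0n.
set Q := r s a + gamma * avg (Ph s a) V.
have dPh := kernel_dist kPh s a; have dPs := kernel_dist kP s a.
have Q0 : 0 <= Q.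
  rewrite addr_ge0 ?mulr_ge0 //; first by case/andP: (r01 s a).
  by apply: avg_ge => // x; case/andP: (Vdisc_bounds x ppihat).
have Qb : Q <= b^-1.
  have -> : b^-1 = 1 + gamma * b^-1 by rewrite /gamma; field; rewrite gt_eqF.
  apply: lerD; first by case/andP: (r01 s a).
  by rewrite ler_wpM2l // avg_le // => x; case/andP: (Vdisc_bounds x ppihat).
(* Rounds the true backup [Q] down to the grid; [Q <= 1 / b <= n] keeps the index below [n^2]. *)
pose j := Num.truncn (n%:R * Q).
have nQ0 : 0 <= n%:R * Q by rewrite mulr_ge0.
have /andP[jl ju] := truncn_itv nQ0; rewrite -/j in jl ju.
have jn : (j <= n ^ 2)%N.
  rewrite -(ler_nat R) natrX; apply: le_trans jl _.
  rewrite expr2 ler_wpM2l ?(ltW nR) //; apply: le_trans Qb _.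
  rewrite -[leRHS]invrK lef_pV2 ?posrE //; apply: le_trans nb _.
  by rewrite expr2 ler_piMl // ltW.
have jQ : `|j%:R / n%:R - Q| <= n%:R^-1.
  have -> : j%:R / n%:R - Q = (j%:R - n%:R * Q) / n%:R by field; rewrite gt_eqF.
  rewrite normrM (gtr0_norm inv0) ler_piMl ?(ltW inv0) //.
  rewrite ler_norml; apply/andP; split; last by lra.
  by move: ju; rewrite -natr1; lra.
have g01' : 0 < gamma < 1 by rewrite g1 andbT /gamma subr_gt0.
have VW := loo_value_approx kPh g01' near_optimal_residual jQ.
have := concentration_loo s a jn; move: VW.
set W := loo_value _ _ _ _ _ _ => VW /= conc.
have {}VW x : `|V x - W x| <= 3 * b.
  apply: le_trans (VW k _ _ x) _ => [y||].
  - by rewrite b_gamma; exact: Vdisc_bounds.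
  - by rewrite b_gamma.
  rewrite b_gamma; have : (n%:R^-1 + n%:R^-1) / b <= 2 * b.
    by rewrite ler_pdivrMr // -mulrA -expr2 mulr_natl mulr2n lerD.
  by move=> nb2; apply: (le_trans (lerD nb2 (lexx b))); lra.
have VW1 x : V x - W x <= 3 * b by exact: ler_normlW.
have VW2 x : W x - V x <= 3 * b by apply: ler_normlW; rewrite distrC.
(* The sandwich gives [V] span at most [H + H + (2 H + 1)], and replacing [V] by [W] costs [3 b] at
   each of two states. The final 13 is [1 + 6] from here plus [3 + 3] from exchanging [V] and [W] in
   the two averages. *)
have spW : sp_norm W <= 4 * H + 1 + 6 * b.
  apply: (sp_norm_le s) => x y.
  have := V_upper m_min x; have := V_lower m_min y.
  have := VW2 x; have := VW1 y; have := le_sp_norm h x y; rewrite -/H; lra.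
have dV p : is_dist p -> `|avg p V - avg p W| <= 3 * b.
  by move=> dp; rewrite -avgB; exact: avg_norm.
have -> : avg (P s a) V - avg (Ph s a) V =
   (avg (P s a) V - avg (P s a) W) + (avg (P s a) W - avg (Ph s a) W)
   - (avg (Ph s a) V - avg (Ph s a) W) by ring.
apply: (le_trans (ler_normB _ _)).
have := ler_normD (avg (P s a) V - avg (P s a) W) (avg (P s a) W - avg (Ph s a) W).
have := dV _ dPs; have := dV _ dPh.
have := ler_wpM2r (ltW b0) spW.
have : b * b <= b by rewrite ler_piMl // ltW.
lra.
Qed.

Lemma empirical_gain_bound s : rho - gain P r pihat s <= 14 * b * (H + 1).
Proof.
have [b0 b1] := andP b01; have [g0 /ltW g1] := andP g01.
have [m' Hm'] := exists_argmax (fun x => - h x) s.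
have m_min x : h m' <= h x by rewrite -lerN2.
have dM x := Ppi_dist kP x ppihat.
have H0 : 0 <= H by apply: le_trans (le_sp_norm h s s); rewrite subrr.
(* Comes from [r = b V + gamma (V - Phat V)]. The losses [2 H + 1] and [4 H + 13] add up to
   [6 H + 14], whence the factor 14. *)
have lower x : (rho - b * (2 * H + 1)) + gamma * (V x - step (Ppi P pihat) V x)
    - (4 * H + 13) * b <= rpi r pihat x.
  have VE := VdiscE r kPh x ppihat g01; rewrite -/V in VE.
  have conc : avg (Ppi Ph pihat x) V <= step (Ppi P pihat) V x + (4 * H + 13) * b.
    have [pi0 pi1] := ppihat.
    set err := (4 * H + 13) * b.
    rewrite /step !avg_Ppi -[err]mul1r -(pi1 x) mulr_suml -big_split /=.
    apply: ler_sum => a _; rewrite -mulrDr ler_wpM2l //.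
    have := empirical_value_concentration x a; rewrite ler_norml => /andP[lo up].
    by rewrite -/err in lo up *; lra.
  have := V_lower m_min x; have := m_min x => hx Vlow.
  have bV : rho - b * (2 * H + 1) <= b * V x.
    apply: (@le_trans _ _ (b * (rho / b + (h x - h m') - (2 * H + 1)))).
      have -> : b * (rho / b + (h x - h m') - (2 * H + 1)) =
        rho + b * (h x - h m') - b * (2 * H + 1) by field; rewrite gt_eqF.
      by rewrite lerD2r lerDl mulr_ge0 ?(ltW b0) // subr_ge0.
    by rewrite ler_wpM2l // ltW.
  have c0 : 0 <= (4 * H + 13) * b by rewrite mulr_ge0 ?(ltW b0) //; lra.
  have := ler_wpM2l g0 conc; have : gamma * ((4 * H + 13) * b) <= (4 * H + 13) * b.
    by rewrite ler_piMl.
  have : V x = b * V x + gamma * V x by rewrite /gamma; ring.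
  lra.
have ds := stat_dist dM s.
have := avg_mono ds.1 lower.
have cob : avg (stat (Ppi P pihat) s) (fun x => V x - step (Ppi P pihat) V x) = 0.
  by rewrite (avgB _ V) stat_step // subrr.
rewrite -gainE // avgB avgD !avg_cst // avgZ cob mulr0.
by have := mulr_ge0 (ltW b0) H0; lra.
Qed.

End EmpiricalPlanning.

(** * Numerical constants *)

Section Constants.
Variable R : realType.

Lemma small_power (g e : R) : 0 <= g < 1 -> 0 < e -> exists k, g ^+ k <= e.
Proof.
case/andP=> g0 g1 e0; have gn : `|g| < 1 by rewrite ger0_norm.
have /cvgr0Pnorm_le /(_ e e0) [k _ /(_ k (leqnn k))] := cvg_geometric 1 gn.
by rewrite /geometric /= mul1r ger0_norm ?exprn_ge0 // => ?; exists k.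
Qed.

Lemma ln2_ge : 1 / 2 <= ln (2 : R).
Proof.
have := expR_ge1Dx (- (1 / 2) : R); rewrite expRN => H.
have e0 := expR_gt0 (1 / 2 : R).
rewrite -(expRK (1 / 2 : R)) ler_ln ?posrE //.
rewrite -[leLHS]invrK -[leRHS]invrK lef_pV2 ?posrE ?invr_gt0 //; lra.
Qed.

(** Each pair carries [n^2 + 1] grid values and [h], hence the count [n^2 + 2]. As [L >= 1/2], the
    exponent [8 L^3] is at least [2 L]: one factor [exp (- L)] pays for the number of events and
    [d], the other, at most 1/4, for the numerical constant. *)
Lemma failure_probability (d N n L : R) : 0 < d < 1 -> 1 <= N -> 2 <= n ->
  L = ln (N * n ^+ 2 / d) ->
  N * (n ^+ 2 + 2) * (2 * expR (- (64 * L ^+ 3 / 8))) <= d.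
Proof.
case/andP=> d0 d1 N1 n2 LE; set X := N * n ^+ 2 / d in LE.
have n4 : 4 <= n ^+ 2.
  have : 0 <= (n - 2) * (n + 2) by rewrite mulr_ge0 //; lra.
  by lra.
have X4 : 4 <= X.
  rewrite ler_pdivlMr //; apply: (@le_trans _ _ (1 * n ^+ 2)); first by lra.
  by rewrite ler_wpM2r //; lra.
have X0 : 0 < X by lra.
have L2 : 1 / 2 <= L.
  by apply: le_trans ln2_ge _; rewrite LE ler_ln ?posrE //; lra.
have expL : expR L = X by rewrite LE lnK.
have e0 : 0 < expR (- L) by exact: expR_gt0.
have XE : expR (- L) * X = 1 by rewrite -expL -expRD addNr expR0.
have e4 : expR (- L) * 4 <= 1 by rewrite -[leRHS]XE ler_wpM2l // ltW.
have L3 : 2 * L <= 64 * L ^+ 3 / 8.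
  have : 0 <= L * (L - 1 / 2) * (L + 1 / 2) by rewrite !mulr_ge0 //; lra.
  have -> : L ^+ 3 = L * (L - 1/2) * (L + 1/2) + L / 4 by field.
  by lra.
apply: (@le_trans _ _ (N * (2 * n ^+ 2) * (2 * (expR (- L) * expR (- L))))).
  have E0 := expR_ge0 (- (64 * L ^+ 3 / 8)).
  apply: ler_pM => //; rewrite ?mulr_ge0 //; try lra.
    by rewrite ler_wpM2l //; lra.
  by rewrite ler_wpM2l // -expRD ler_expR; lra.
have -> : N * (2 * n ^+ 2) * (2 * (expR (- L) * expR (- L))) =
    d * (expR (- L) * X) * (expR (- L) * 4) by rewrite /X; field; rewrite gt_eqF.
by rewrite XE mulr1 ler_piMr // ltW.
Qed.

(** [392 = 2 * 14^2], the 2 coming from [(H + 1)^2 <= 2 (H^2 + 1)]; [512 = 64 * 2^3] from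
    [L <= 2 L']. *)
Lemma final_rate (n L L' H b : R) : 0 < n -> 0 <= L -> L <= 2 * L' -> 0 <= H ->
  b = Num.sqrt (64 * L ^+ 3 / n) ->
  14 * b * (H + 1) <= Num.sqrt (392 * 512 * L' ^+ 3 / n * (H ^+ 2 + 1)).
Proof.
move=> n0 L0 LL' H0 bE.
have L3 : L ^+ 3 <= 8 * L' ^+ 3.
  have -> : 8 * L' ^+ 3 = (2 * L') ^+ 3 by ring.
  by rewrite lerXn2r ?nnegrE //; apply: le_trans LL'.
have b0 : 0 <= b by rewrite bE sqrtr_ge0.
have b2 : b ^+ 2 = 64 * L ^+ 3 / n.
  by rewrite bE sqr_sqrtr // divr_ge0 ?(ltW n0) // mulr_ge0 // exprn_ge0.
have bb : b ^+ 2 <= 512 * L' ^+ 3 / n.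
  by rewrite b2 ler_wpM2r ?invr_ge0 ?(ltW n0) //; lra.
have b20 : 0 <= b ^+ 2 by rewrite exprn_ge0.
have lhs0 : 0 <= 14 * b * (H + 1) by rewrite !mulr_ge0 //; lra.
rewrite -(ger0_norm lhs0) -sqrtr_sqr ler_sqrt; last first.
  have : 0 <= 512 * L' ^+ 3 / n by exact: le_trans bb.
  move=> T0; have -> : 392 * 512 * L' ^+ 3 / n = 392 * (512 * L' ^+ 3 / n) by ring.
  apply: mulr_ge0; last by rewrite addr_ge0 // sqr_ge0.
  by apply: mulr_ge0 T0; rewrite ler0n.
have -> : 392 * 512 * L' ^+ 3 / n * (H ^+ 2 + 1) =
  392 * ((512 * L' ^+ 3 / n) * (H ^+ 2 + 1)) by ring.
have H1 : (H + 1) ^+ 2 <= 2 * (H ^+ 2 + 1).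
  by have := sqr_ge0 (H - 1); rewrite !sqrrD; lra.
have H2 : 0 <= H ^+ 2 + 1 by rewrite addr_ge0 ?sqr_ge0.
have := ler_wpM2r H2 bb; have := ler_wpM2l b20 H1.
rewrite !exprMn; lra.
Qed.

End Constants.

(** * Union bound and conclusion *)

(** Settles the case of one action, where [|S| |A|] may be 1 and [L] too small for the union
    bound. *)
Lemma policy_unique (R : realType) (S A : finType) (pi pi' : S -> A -> R) :
  (#|A| <= 1)%N -> is_policy pi -> is_policy pi' -> pi = pi'.
Proof.
move=> A1 [_ pi1] [_ pi1']; apply/funext => s; apply/funext => a.
have sumE (F : A -> R) : \sum_b F b = F a.
  rewrite (bigD1 a) //= big1 ?addr0 // => b; rewrite (fintype_le1P A1 b a).
  by rewrite eqxx.
by have := pi1 s; rewrite -(pi1' s) !sumE.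
Qed.

Theorem planning_bound (R : realType) (S A : finType) (P : S -> A -> S -> R)
    (r : S -> A -> R) (delta : R) (n : nat) (pistar : S -> A -> R) :
  is_kernel P -> (forall s a, 0 <= r s a <= 1) -> weakly_communicating P ->
  0 < delta < 1 -> (0 < #|S|)%N -> (1 < #|A|)%N -> (0 < n)%N ->
  let L := ln (#|S|%:R * #|A|%:R * (n%:R ^+ 2) / delta) in
  let b := Num.sqrt (64 * L ^+ 3 / n%:R) in
  0 < b < 1 -> blackwell_optimal P r pistar ->
  1 - delta <= Prob P n (fun w => forall pihat, is_policy pihat ->
    (forall s, Vdisc (Phat n w) r (1 - b) pihat s >=
       Vopt (Phat n w) r (1 - b) s - n%:R^-1) ->
    forall s, gain P r pistar s - gain P r pihat s <=
      14 * b * (sp_norm (bias P r pistar) + 1)).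
Proof.
move=> kP r01 wc d01 S0 A1 n0 L b b01 bpi; have [b0 b1] := andP b01.
have ppi := blackwell_policy bpi; have dM x := Ppi_dist kP x ppi.
have [s0 _] : exists s0, s0 \in S by apply/card_gt0P.
have nR : 0 < n%:R :> R by rewrite ltr0n.
have [d0 d1] := andP d01.
set h := bias P r pistar; pose rho := gain P r pistar s0.
have rhoE s : gain P r pistar s = rho by exact: gain_constant.
have hE : h = stat_bias (Ppi P pistar) (rpi r pistar).
  by apply/funext => x; exact: biasE.
have poisson_h s : rho + h s = rpi r pistar s + avg (Ppi P pistar s) h.
  have [/(_ s) pE _] := poisson_equation dM (rpi r pistar).
  by move: pE; rewrite -hE -gainE // rhoE /step => ->; ring.
have bell := bellman_inequality kP bpi rhoE.
have g01 : 0 <= 1 - b < 1 by apply/andP; split; lra.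
have [k kb] := small_power g01 (exprn_gt0 2 b0).
have N1 : 1 <= #|S|%:R * #|A|%:R :> R by rewrite -natrM ler1n muln_gt0 S0 ltnW.
have N2 : 2 <= #|S|%:R * #|A|%:R :> R.
  rewrite -natrM (ler_nat R 2); apply: leq_trans A1 _; exact: leq_pmull.
have L2 : 1 / 2 <= L.
  apply: le_trans (ln2_ge R) _; rewrite ler_ln ?posrE //; last first.
    by rewrite divr_gt0 // mulr_gt0 ?exprn_gt0 //; lra.
  rewrite ler_pdivlMr //; apply: (@le_trans _ _ (2 * 1)); first by rewrite ler_wpM2l // ltW.
  by apply: ler_pM => //; rewrite -natrX ler1n expn_gt0 n0.
have L3 : 1 / 8 <= L ^+ 3.
  have -> : 1 / 8 = (1 / 2) ^+ 3 :> R by field.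
  by rewrite lerXn2r ?nnegrE //; lra.
have b2 : b ^+ 2 = 64 * L ^+ 3 / n%:R.
  by rewrite sqr_sqrtr // divr_ge0 ?(ltW nR) //; lra.
have nb2 : n%:R * b ^+ 2 = 64 * L ^+ 3 by rewrite b2; field; rewrite gt_eqF.
(* [b < 1] and [n b^2 = 64 L^3 >= 8] rule out small [n]. *)
have n2 : 2 <= n%:R :> R.
  have : n%:R * b ^+ 2 <= n%:R by rewrite ler_piMr ?(ltW nR) // expr_le1 // ltW.
  by rewrite nb2; lra.
have nb : n%:R^-1 <= b ^+ 2.
  by rewrite -[leLHS]mulr1 ler_pdivrMl // nb2; lra.
(* [None] indexes the fixed function [h], [Some j] the leave-one-out value with backup frozen at
   [j / n]. *)
pose F (x : S * A * option 'I_(n ^ 2).+1) (w : {ffun S * A -> n.-tuple S}) : S -> R :=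
  if x.2 is Some j then loo_value (1 - b) r k x.1 (j%:R / n%:R) (Phat n w) else h.
pose bad x w := sp_norm (F x w) * b <
  `|avg (P x.1.1 x.1.2) (F x w) - avg (Phat n w x.1.1 x.1.2) (F x w)|.
have badP x : Prob P n (bad x) <= 2 * expR (- (n%:R * b ^+ 2 / 8)).
  apply: leave_one_out_deviation => //; first by rewrite !ltW.
  move=> w w' ww'; rewrite /F; case: x.2 => // j.
  rewrite /loo_value; congr (iter k (bellman _ _ _) _).
  apply/funext => s; apply/funext => a; rewrite /loo_kernel.
  case: eqP => // /eqP sa; apply/funext => s'; rewrite /Phat ww' //.
apply: le_trans (_ : 1 - Prob P n (fun w => exists x, bad x w) <= _); last first.
  apply: Prob_compl_ge => // w nobad pihat ppihat near s.
  have good x : `|avg (P x.1.1 x.1.2) (F x w) - avg (Phat n w x.1.1 x.1.2) (F x w)| <=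
      sp_norm (F x w) * b.
    by rewrite leNgt; apply/negP => B; apply: nobad; exists x.
  rewrite rhoE; apply: (empirical_gain_bound kP (Phat_kernel R w n0) r01 b01 ppi
    bell poisson_h n0 nb kb) => //.
  - by move=> x a; exact: (good (x, a, None)).
  - move=> x a j jn; rewrite -ltnS in jn.
    exact: (good (x, a, Some (Ordinal jn))).
rewrite lerD2l lerN2.
apply: (le_trans (Prob_union kP (E := bad) (F := fun w => exists x, bad x w) _)) => //.
apply: (@le_trans _ _ (\sum_(x : S * A * option 'I_(n ^ 2).+1)
   2 * expR (- (n%:R * b ^+ 2 / 8)))); first by apply: ler_sum => x _; exact: badP.
rewrite sumr_const -[leLHS]mulr_natl nb2.
rewrite !card_prod card_option card_ord !natrM -addn2 natrD natrX.
exact: failure_probability.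
Qed.

Theorem mainTheorem12 (R : realType) :
  exists C C' : R, 0 < C /\ 0 < C' /\
  forall (S A : finType) (P : S -> A -> S -> R) (r : S -> A -> R),
    is_kernel P ->
    (forall s a, 0 <= r s a <= 1) ->
    weakly_communicating P ->
  forall (delta : R) (n : nat), 0 < delta < 1 ->
  let gamma := 1 - Num.sqrt (C * (ln (#|S|%:R * #|A|%:R * (n%:R ^+ 2) / delta)) ^+ 3 / n%:R) in
  0 < gamma < 1 ->
  forall pistar : S -> A -> R, blackwell_optimal P r pistar ->
  Prob P n (fun w =>
    forall pihat : S -> A -> R, is_policy pihat ->
      (forall s, Vdisc (Phat n w) r gamma pihat s >= Vopt (Phat n w) r gamma s - n%:R^-1) ->
      forall s, gain P r pistar s - gain P r pihat s <=
        Num.sqrt (C' * (ln (#|S|%:R * #|A|%:R * n%:R / delta)) ^+ 3 / n%:R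
                  * ((sp_norm (bias P r pistar)) ^+ 2 + 1)))
  >= 1 - delta.
Proof.
exists 64, (392 * 512); split; first by rewrite ltr0n.
split; first by apply: mulr_gt0; rewrite ltr0n.
move=> S A P r kP r01 wc delta n d01 gamma g01 pistar bpi.
have [d0 d1] := andP d01; have [ppi _] := bpi.
pose L := ln (#|S|%:R * #|A|%:R * (n%:R ^+ 2) / delta).
pose b := Num.sqrt (64 * L ^+ 3 / n%:R).
have b01 : 0 < b < 1.
  by move: g01; rewrite /gamma -/L -/b => /andP[? ?]; apply/andP; split; lra.
have b_arg : 0 < 64 * L ^+ 3 / n%:R by case/andP: b01; rewrite sqrtr_gt0.
(* With the conventions [0^-1 = 0] and [ln 0 = 0], the degenerate sizes would give [b = 0],
   contradicting [gamma < 1]. *)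
have n0 : (0 < n)%N.
  by rewrite lt0n; apply: contraTneq b_arg => ->; rewrite invr0 mulr0 ltxx.
have SA0 : (0 < #|S| * #|A|)%N.
  rewrite lt0n; apply: contraTneq b_arg => SA0.
  by rewrite /L -natrM SA0 !mul0r ln0 // expr0n /= mulr0 mul0r ltxx.
have [S0 A0] : (0 < #|S|)%N /\ (0 < #|A|)%N by apply/andP; rewrite -muln_gt0.
have [A1|A1] := leqP #|A| 1.
  apply: le_trans (_ : 1 - Prob P n (fun=> False) <= _).
    by rewrite lerD2l lerN2 ProbE big1 ?ltW // => w _; rewrite asboolF ?mulr0.
  apply: Prob_compl_ge => // w _ pihat ppihat _ s.
  by rewrite (policy_unique A1 ppihat ppi) subrr sqrtr_ge0.
apply: le_trans (planning_bound kP r01 wc d01 S0 A1 n0 b01 bpi) _.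
rewrite !ProbE; apply: ler_sum => w _.
rewrite ler_wpM2l ?sample_prob_ge0 //; case: asboolP => // E.
rewrite asboolT // => pihat ppihat near s.
apply: le_trans (E pihat ppihat near s) _.
have nR : 1 <= n%:R :> R by rewrite ler1n.
have SAR : 1 <= #|S|%:R * #|A|%:R :> R by rewrite -natrM ler1n.
have y1 : 1 <= #|S|%:R * #|A|%:R / delta :> R by rewrite ler_pdivlMr //; lra.
have Y0 : 0 < #|S|%:R * #|A|%:R / delta :> R by lra.
have n0R : 0 < n%:R :> R by lra.
have lnY : 0 <= ln (#|S|%:R * #|A|%:R / delta) :> R by rewrite ln_ge0.
have lnn : 0 <= ln n%:R :> R by rewrite ln_ge0.
(* The logarithm in the conclusion has a single [ln n]; as both summands are nonnegative, [L] is at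
   most twice it. *)
have LE : L = ln (#|S|%:R * #|A|%:R / delta) + (ln n%:R + ln n%:R).
  by rewrite /L mulrAC (lnM Y0) ?posrE ?exprn_gt0 // expr2 (lnM n0R).
apply: (@final_rate _ n%:R L) => //; first by rewrite LE !addr_ge0.
  by rewrite LE [_ * n%:R / _]mulrAC (lnM Y0) //; lra.
by apply: le_trans (le_sp_norm _ s s); rewrite subrr.
Qed.
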